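(* Let $\mathbf{p}=(p,s)$ with $p\in(0,1]$, $s\in\mathbb{R}$, and let $c$ be a Whitney parameter. Then $f\in L^0(\mathbb{R}^{1+n}_+)$ belongs to $Z^{\mathbf{p}}$ if and only if there exist a sequence $(a_k)_{k\in\mathbb{N}}$ of $Z^{\mathbf{p}}_c$-atoms and $\lambda\in\ell^p(\mathbb{N})$ such that $f=\sum_{k}\lambda_ka_k$ with convergence in $Z^{\mathbf{p}}$. Moreover $\|f\|_{Z^{\mathbf{p}}}\simeq\inf\|\lambda\|_{\ell^p(\mathbb{N})}$, the infimum taken over all such decompositions.
   Context: Fix $n,N\ge1$; functions on $\mathbb{R}^{1+n}_+:=(0,\infty)\times\mathbb{R}^n$ are $\mathbb{C}^N$-valued. A Whitney parameter is $c=(c_0,c_1)\in(0,\infty)\times(3/2,\infty)$, with Whitney region $\Omega_c(t,x):=(c_1^{-1}t,c_1t)\times B(x,c_0t)$ and $\mathcal{W}_cf(t,x):=\big(|\Omega_c(t,x)|^{-1}\iint_{\Omega_c(t,x)}|f|^2\big)^{1/2}$. For $\mathbf{p}=(p,s)$, $\|f\|_{Z^{\mathbf{p}}}:=\|\mathcal{W}_{(1,2)}(\kappa^{-s}f)\|_{L^p(\mathbb{R}^{1+n}_+,dx\,dt/t)}$ where $\kappa^{-s}f(t,x)=t^{-s}f(t,x)$, and $Z^{\mathbf{p}}$ is the set of $f$ with finite quasinorm. A $Z^{\mathbf{p}}_c$-atom associated with $(t,x)\in\mathbb{R}^{1+n}_+$ is a function $a$ essentially supported in $\Omega_c(t,x)$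 with $\|\kappa^{-s}a\|_{L^2(\Omega_c(t,x),dx\,dt/t)}\le t^{n\delta_{p,2}}$, where $\delta_{p,2}:=\frac12-\frac1p$. *)

(* Defs.v *)
From HB Require Import structures.
From mathcomp Require Import all_boot all_order all_algebra.
From mathcomp Require Import all_classical all_reals all_analysis.
From mathcomp Require Import complex.
Unset Printing Implicit Defensive.
Import Order.TTheory GRing.Theory Num.Theory.
Import numFieldNormedType.Exports.
Local Open Scope classical_set_scope.
Local Open Scope ring_scope.

Section Defs.
Context {R : realType}.

(* Lebesgue measure on R^n, with R^n represented as n.-tuple R (Borel
   product sigma-algebra), defined as the iterated product measure
   lambda_{n+1} = (lambda_1 (x) lambda_n) transported along (x, y) |-> x :: y;
   lambda_0 is the unit point mass on the unique 0-tuple. *)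
Fixpoint lebn (n : nat) : set (n.-tuple R) -> \bar R :=
  match n return set (n.-tuple R) -> \bar R with
  | 0 => fun A => (\1_A [tuple])%:E
  | m.+1 => fun A =>
      (product_measure1 (lebesgue_measure : set R -> \bar R) (lebn m))
        ((fun p : R * m.-tuple R => cons_tuple p.1 p.2) @^-1` A)
  end.

Definition lebT (n : nat) : set (R * n.-tuple R) -> \bar R :=
  product_measure1 (lebesgue_measure : set R -> \bar R) (lebn n).

Definition halfspace (n : nat) : set (R * n.-tuple R) := [set z | 0 < z.1].

Definition edist {n : nat} (x y : n.-tuple R) : R :=
  Num.sqrt (\sum_(i < n) (tnth x i - tnth y i) ^+ 2).

Definition eball {n : nat} (x : n.-tuple R) (r : R) : set (n.-tuple R) :=
  [set y | edist x y < r].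

Definition whitney_param (c : R * R) : Prop := 0 < c.1 /\ 3 / 2 < c.2.

Definition whitney_region (n : nat) (c : R * R) (z : R * n.-tuple R)
  : set (R * n.-tuple R) :=
  [set w | c.2^-1 * z.1 < w.1 /\ w.1 < c.2 * z.1 /\ w.2 \in eball z.2 (c.1 * z.1)].

(* C^N-valued functions on R x R^n (only their values on the half-space
   matter); C^N is represented as 'rV[R[i]]_N. *)
Definition vfun (n N : nat) := R * n.-tuple R -> 'rV[R[i]]_N.

Definition cabs2 (z : R[i]) : R := complex.Re z ^+ 2 + complex.Im z ^+ 2.
Definition vnorm2 {N : nat} (v : 'rV[R[i]]_N) : R := \sum_(j < N) cabs2 (v ord0 j).
Definition cabs (z : R[i]) : R := Num.sqrt (cabs2 z).

Definition L0 {n N : nat} (f : vfun n N) : Prop :=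
  forall j : 'I_N,
    measurable_fun (halfspace n) (fun z => complex.Re (f z ord0 j)) /\
    measurable_fun (halfspace n) (fun z => complex.Im (f z ord0 j)).

Definition kappa {n N : nat} (s : R) (f : vfun n N) : vfun n N :=
  fun z => ((z.1 `^ (- s))%:C)%C *: f z.

Definition whitney_avg {n N : nat} (c : R * R) (f : vfun n N)
  (z : R * n.-tuple R) : \bar R :=
  (((fine (lebT n (whitney_region n c z)))^-1%:E *
   \int[lebT n]_(w in whitney_region n c z) (vnorm2 (f w))%:E) `^ (2^-1)%R)%E.

Definition Znorm {n N : nat} (p s : R) (f : vfun n N) : \bar R :=
  ((\int[lebT n]_(z in halfspace n)
      (whitney_avg (1%R, 2%R) (kappa s f) z `^ p * (z.1^-1)%:E)) `^ (p^-1)%R)%E.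

Definition in_Z {n N : nat} (p s : R) (f : vfun n N) : Prop :=
  L0 f /\ (Znorm p s f < +oo)%E.

Definition Zatom {n N : nat} (p s : R) (c : R * R) (z : R * n.-tuple R)
  (a : vfun n N) : Prop :=
  0 < z.1 /\ L0 a /\
  (lebT n).-negligible
     [set w | w \in halfspace n /\ w \notin whitney_region n c z /\ a w != 0] /\
  ((\int[lebT n]_(w in whitney_region n c z)
       ((vnorm2 (kappa s a w))%:E * (w.1^-1)%:E)) `^ (2^-1)%R <=
     (z.1 `^ (n%:R * (2^-1 - p^-1)))%:E)%E.

Definition lpnorm (p : R) (lam : nat -> R[i]) : \bar R :=
  ((\sum_(0 <= k <oo) ((cabs (lam k)) `^ p)%:E) `^ (p^-1)%R)%E.

Definition atomic_decomp {n N : nat} (p s : R) (c : R * R) (f : vfun n N)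
  (a : nat -> vfun n N) (lam : nat -> R[i]) : Prop :=
  (forall k, exists z, Zatom p s c z (a k)) /\
  (lpnorm p lam < +oo)%E /\
  (fun m => Znorm p s (fun w => f w - \sum_(k < m) lam k *: a k w))
     @ \oo --> 0%E.

Definition decomp_norms {n N : nat} (p s : R) (c : R * R) (f : vfun n N)
  : set (\bar R) :=
  [set l | exists a lam, atomic_decomp p s c f a lam /\ l = lpnorm p lam].

End Defs.
Arguments vfun R n N : clear implicits.

(* Main.v *)
Require Import Defs.
From HB Require Import structures.
From mathcomp Require Import all_boot all_order all_algebra.
From mathcomp Require Import all_classical all_reals all_analysis.
From mathcomp Require Import measurable_realfun complex.
From mathcomp Require Import ring lra.
Import Order.TTheory GRing.Theory Num.Theory.
Local Open Scope classical_set_scope.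
Local Open Scope ring_scope.
Set Implicit Arguments.
Unset Strict Implicit.

(* Write G = |kappa^-s f|^2 and q = p/2 <= 1/2. Then ||f||_Z^p is the integral
   over the half-space of (mean of G over Omega(z))^q dz/t, which is
   subadditive in f by Minkowski and countably subadditive in G because
   (sum x_k)^q <= sum x_k^q.
   If G lives on Omega_c(t0, x0), its Whitney means vanish off a cylinder of
   dxdt/t-measure ~ t0^n and are there at most ~ t0^-n A, where A is the dxdt/t
   integral of G; hence ||f||_Z^p <= C t0^(n(1-q)) A^q, so atoms are uniformly
   bounded, and subadditivity bounds the norm of a sum.
   Conversely cut the half-space into cells Q_k with sides ~ t_k, each inside
   the region Omega(z) of all its points z. The Whitney mean of G at any point
   of Q_k is at least ~ t_k^-n A_k, so lambda_k^p := t_k^(n(1-q)) A_k^q is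
   controlled by the part over Q_k of the integral defining ||f||_Z^p; the atoms
   are 1_(Q_k) f / lambda_k, and the tails of the resulting series are bounded
   by the first estimate. *)

(** * Lebesgue measure on tuples *)

Lemma sigma_finite_product d1 d2 (T1 : measurableType d1)
    (T2 : measurableType d2) (R : realType)
    (m1 : {sigma_finite_measure set T1 -> \bar R})
    (m2 : {sigma_finite_measure set T2 -> \bar R}) :
  sigma_finite setT (m1 \x m2)%E.
Proof.
have [F TF Foo] := sigma_finiteT m1; have [G TG Goo] := sigma_finiteT m2.
have /card_esym/ppcard_eqP[g] := card_nat2.
exists (fun i => F (g i).1 `*` G (g i).2) => [|i].
  apply/seteqP; split=> // -[x y] _.
  have [[i _ Fx] [j _ Gy]] : (\bigcup_i F i) x /\ (\bigcup_i G i) y.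
    by rewrite -TF -TG.
  by exists (g^-1%FUN (i, j)) => //; rewrite invK ?inE.
have [? ?] := Foo (g i).1; have [? ?] := Goo (g i).2.
split; first exact: measurableX.
by rewrite product_measure1E// lte_mul_pinfty// ge0_fin_numE.
Qed.

Section lebesgue_measure_tuple.
Context {R : realType}.

(* [lebesgue_measure] lives on [measurableTypeR R], whose display differs from
   the canonical one of [R]; products over [R] need it on the latter. *)
Definition lebR : set R -> \bar R := lebesgue_measure.

Let lebR0 : lebR set0 = 0%E.
Proof. exact: (@measure0 _ _ _ (@lebesgue_measure R)). Qed.

Let lebR_ge0 A : (0 <= lebR A)%E.
Proof. exact: (@measure_ge0 _ _ _ (@lebesgue_measure R)). Qed.

Let lebR_sigma_additive : semi_sigma_additive lebR.
Proof. exact: (@measure_semi_sigma_additive _ _ _ (@lebesgue_measure R)). Qed.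

HB.instance Definition _ := isMeasure.Build _ _ _ lebR
  lebR0 lebR_ge0 lebR_sigma_additive.

Let lebR_sigma_finite : sigma_finite setT lebR.
Proof. exact: (@sigma_finiteT _ _ _ (@lebesgue_measure R)). Qed.

HB.instance Definition _ := Measure_isSigmaFinite.Build _ _ _ lebR
  lebR_sigma_finite.

Let mcons n (q : R * n.-tuple R) : n.+1.-tuple R := cons_tuple q.1 q.2.

Lemma measurable_cons_tuple n : measurable_fun setT (@mcons n).
Proof. exact: measurable_cons. Qed.

(** The product with [lebn n] is a measure through sigma-finiteness of [lebn n], so both properties
    are carried together through an induction on [n]. *)
Lemma lebn_sigma_finite_measure n :
  exists m : {sigma_finite_measure set (n.-tuple R) -> \bar R},
    m = lebn n :> (set _ -> \bar R).
Proof.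
elim: n => [|n [m mE]].
  exists [the {sigma_finite_measure set (0.-tuple R) -> \bar R} of dirac [tuple]].
  by apply/funext => A; rewrite /= diracE indicE.
pose P : {measure set (R * n.-tuple R)%type -> \bar R} := (lebR \x m)%E.
pose pf : {measure set _ -> \bar R} := pushforward P (@mcons n).
pose M := pf (@measurable_cons_tuple n).
have sf : sigma_finite setT M.
  have [F FT Foo] := sigma_finite_product lebR m.
  (* [g] splits a tuple into head and tail. Pulling the exhausting sets back along it keeps their
     measure, since [g] undoes [mcons]. *)
  pose g (y : n.+1.-tuple R) := (thead y, [tuple of behead y]).
  have gK : cancel (@mcons n) g.
    by move=> [a b]; rewrite /g theadE; congr pair; exact/val_inj.
  have mg : measurable_fun setT g.
    apply/measurable_fun_pairP.
    by split; [exact: measurable_tnth|exact: measurable_behead].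
  exists (fun i => g @^-1` F i).
    by rewrite -preimage_bigcup -FT preimage_setT.
  move=> i; have [mF Fi] := Foo i; split.
    by rewrite -[X in measurable X]setTI; exact: mg.
  rewrite /= /pushforward -comp_preimage (_ : _ \o _ = id) ?preimage_id//.
  by apply/funext => q; exact: gK.
pose MS : {sigma_finite_measure set _ -> \bar R} :=
  HB.pack (M : set _ -> \bar R) (Measure.on M)
    (Measure_isSigmaFinite.Build _ _ _ M sf).
by exists MS; apply/funext => A /=; rewrite /pushforward -mE.
Qed.

Let lebn0 n : lebn n set0 = 0%E :> \bar R.
Proof. by have [m <-] := lebn_sigma_finite_measure n; exact: measure0. Qed.

Let lebn_ge0 n A : (0 <= lebn n A :> \bar R)%E.
Proof. by have [m <-] := lebn_sigma_finite_measure n; exact: measure_ge0. Qed.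

Let lebn_sigma_additive n : semi_sigma_additive (@lebn R n).
Proof.
by have [m <-] := lebn_sigma_finite_measure n; exact: measure_semi_sigma_additive.
Qed.

HB.instance Definition _ n := isMeasure.Build _ _ _ (@lebn R n)
  (lebn0 n) (@lebn_ge0 n) (@lebn_sigma_additive n).

Let lebn_sigma_finite n : sigma_finite setT (@lebn R n).
Proof.
by have [m <-] := lebn_sigma_finite_measure n; exact: sigma_finiteT.
Qed.

HB.instance Definition _ n := Measure_isSigmaFinite.Build _ _ _ (@lebn R n)
  (lebn_sigma_finite n).

HB.instance Definition _ n := Measure.copy (@lebT R n) (lebR \x lebn n)%E.

HB.instance Definition _ n := Measure_isSigmaFinite.Build _ _ _ (@lebT R n)
  (sigma_finite_product lebR (lebn n)).

End lebesgue_measure_tuple.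

(** * Volume of boxes *)

Section box.
Context {R : realType}.
Implicit Type n : nat.

(** Half-open, so that boxes with corners on a lattice of mesh [l] tile space. *)
Definition box n (l : R) (x : n.-tuple R) : set (n.-tuple R) :=
  [set y | forall i, tnth x i <= tnth y i < tnth x i + l].

Lemma measurable_box n l (x : n.-tuple R) : measurable (box l x).
Proof.
rewrite (_ : box l x = \bigcap_(i in [set: 'I_n])
    (fun y : n.-tuple R => tnth y i) @^-1` `[tnth x i, tnth x i + l[).
  apply: fin_bigcap_measurable => // i _.
  by rewrite -[X in measurable X]setTI; exact: measurable_tnth.
apply/seteqP; split => y /= h i; last by have := h i I; rewrite /= in_itv.
by move=> _; rewrite /= in_itv; exact: h.
Qed.

Lemma lebn_box n l (x : n.-tuple R) : 0 <= l -> lebn n (box l x) = (l ^+ n)%:E.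
Proof.
move=> l0; elim: n x => [|n IHn] x.
  by rewrite /= indicE mem_set//= => -[].
rewrite [LHS](_ : _ = (lebR \x lebn n)%E
    (`[thead x, thead x + l[%classic `*` box l [tuple of behead x])).
  rewrite product_measure1E//=; last exact: measurable_box.
  (* The interval formula tests for non-emptiness; the degenerate case is [l = 0]. *)
  rewrite IHn /lebR lebesgue_measure_itv/= lte_fin ltrDl exprS EFinM.
  case: ltP => // l0'; first by rewrite -EFinD addrC addKr.
  by have -> : l = 0 by [apply/eqP; rewrite eq_le l0 l0'] ; rewrite mul0e.
rewrite /=; congr (_ _); apply/seteqP; split => -[a b] /=.
  move=> h; split => [|i]; first by have := h ord0; rewrite in_itv /= tnth0.
  by have := h (lift ord0 i); rewrite tnthS [in X in X -> _](tuple_eta x) tnthS.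
rewrite in_itv /= => -[ha hb] i.
case: (unliftP ord0 i) => [j|] ->; last by rewrite tnth0.
rewrite tnthS [in X in X <= _](tuple_eta x) [in X in _ < X](tuple_eta x) tnthS.
exact: hb.
Qed.

End box.

(** * Whitney regions *)

Section whitney_geometry.
Context {R : realType}.
Variable n : nat.
Local Notation X := (n.-tuple R).
Local Notation edist := Defs.edist.
Local Notation T := (R * n.-tuple R)%type.
Implicit Types (x y : X) (z w : T) (c : R * R).

Lemma le_tnth_edist x y i : `|tnth x i - tnth y i| <= edist x y.
Proof.
rewrite -sqrtr_sqr /edist ler_wsqrtr// (bigD1 i)//= lerDl.
by apply: sumr_ge0 => j _; exact: sqr_ge0.
Qed.

Lemma edist_le x y (r : R) : 0 <= r -> (forall i, `|tnth x i - tnth y i| <= r) ->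
  edist x y <= n%:R * r.
Proof.
move=> r0 xyr; rewrite -[leRHS]ger0_norm ?mulr_ge0//.
rewrite -sqrtr_sqr /edist ler_wsqrtr//.
apply: (@le_trans _ _ (\sum_(i < n) r ^+ 2)).
  apply: ler_sum => i _; rewrite -(real_normK (num_real (_ - _))).
  by rewrite lerXn2r ?nnegrE// xyr.
(* The crude [n <= n ^ 2] gives the factor [n] instead of its square root, which is enough where
   only the existence of constants matters. *)
rewrite sumr_const card_ord -[leLHS]mulr_natl exprMn ler_wpM2r ?sqr_ge0//.
by rewrite -natrX ler_nat -mulnn; case: (n) => // m; rewrite leq_pmulr.
Qed.

Lemma measurable_edist : measurable_fun setT (fun q : X * X => edist q.1 q.2).
Proof.
have sq0 (q : X * X) : 0 <= \sum_(i < n) (tnth q.1 i - tnth q.2 i) ^+ 2.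
  by apply: sumr_ge0 => i _; exact: sqr_ge0.
rewrite /Defs.edist; under eq_fun do rewrite -powR12_sqrt ?sq0//.
apply: (measurableT_comp (@measurable_powR R _)).
apply: measurable_sum => i; apply: measurable_funX; apply: measurable_funB.
  exact: measurableT_comp (measurable_tnth i) measurable_fst.
exact: measurableT_comp (measurable_tnth i) measurable_snd.
Qed.

Lemma halfspaceE : halfspace n = `]0, +oo[ `*` setT :> set T.
Proof.
apply/seteqP; split => -[a b] /=; rewrite /halfspace/= in_itv/= andbT//.
by case.
Qed.

Lemma measurable_halfspace : measurable (halfspace n : set T).
Proof. by rewrite halfspaceE; exact: measurableX. Qed.

Lemma whitney_regionP c z w : whitney_region n c z w <->
  [/\ c.2^-1 * z.1 < w.1, w.1 < c.2 * z.1 & edist z.2 w.2 < c.1 * z.1].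
Proof.
rewrite /whitney_region/eball/=.
by split => [[? [?]]|[? ? ?]]; rewrite in_setE.
Qed.

(** Joint measurability in centre and point is what Tonelli's theorem needs to make integrals over
    the region of [z] measurable in [z]. *)
Lemma measurable_whitney_graph c :
  measurable [set q : T * T | whitney_region n c q.1 q.2].
Proof.
have m11 : measurable_fun setT (fun q : T * T => q.1.1).
  exact: measurableT_comp measurable_fst measurable_fst.
have m12 : measurable_fun setT (fun q : T * T => q.1.2).
  exact: measurableT_comp measurable_snd measurable_fst.
have m21 : measurable_fun setT (fun q : T * T => q.2.1).
  exact: measurableT_comp measurable_fst measurable_snd.
have m22 : measurable_fun setT (fun q : T * T => q.2.2).
  exact: measurableT_comp measurable_snd measurable_snd.
have mc (a : R) : measurable_fun setT (fun q : T * T => a * q.1.1).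
  exact: measurable_funM.
have mltr (f g : T * T -> R) : measurable_fun setT f -> measurable_fun setT g ->
    measurable [set q | f q < g q].
  move=> mf mg; have h : measurable_fun setT (fun q => f q < g q).
    exact: measurable_fun_ltr.
  have := h measurableT [set true] I.
  by rewrite setTI; congr measurable; apply/seteqP; split.
rewrite (_ : [set _ | _] = [set q | c.2^-1 * q.1.1 < q.2.1] `&`
  [set q | q.2.1 < c.2 * q.1.1] `&` [set q | edist q.1.2 q.2.2 < c.1 * q.1.1]).
  apply: measurableI; [apply: measurableI|]; apply: mltr => //.
  have m2 : measurable_fun setT (fun q : T * T => (q.1.2, q.2.2)).
    exact: measurable_fun_pair.
  exact: measurableT_comp measurable_edist m2.
by apply/seteqP; split => q /=; rewrite whitney_regionP// => -[] // [].
Qed.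

Lemma measurable_whitney_region c z : measurable (whitney_region n c z).
Proof.
rewrite (_ : whitney_region n c z =
    xsection [set q : T * T | whitney_region n c q.1 q.2] z).
  apply: measurable_xsection; exact: measurable_whitney_graph.
by apply/seteqP; split => w; rewrite /xsection/= in_setE.
Qed.

Lemma whitney_sub_halfspace c z : 0 < c.2 -> 0 < z.1 ->
  whitney_region n c z `<=` halfspace n.
Proof.
move=> c0 z0 w /whitney_regionP[zw _ _]; apply: lt_trans zw.
by rewrite mulr_gt0 ?invr_gt0.
Qed.

(** Serves both to enclose Whitney regions and as grid cell; half-open in time too, so that
    consecutive layers are disjoint. *)
Definition cylinder (a b l : R) x : set T := `[a, b[ `*` box l x.

Lemma measurable_cylinder a b l x : measurable (cylinder a b l x).
Proof. by apply: measurableX => //; exact: measurable_box. Qed.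

Lemma lebT_cylinder a b l x : a <= b -> 0 <= l ->
  lebT n (cylinder a b l x) = ((b - a) * l ^+ n)%:E.
Proof.
move=> ab l0; have mb := measurable_box l x.
rewrite [LHS](product_measure1E lebR (lebn n))//= lebn_box// [in LHS]/lebR.
rewrite lebesgue_measure_itv/= lte_fin EFinM.
case: ltP => [_|ba]; first by rewrite EFinB.
by rewrite (_ : b = a) ?subrr//; apply/eqP; rewrite eq_le ab ba.
Qed.

(** The least corner of the cube with centre [x] and side [2 r]. *)
Definition shift_tuple r x : X := [tuple tnth x i - r | i < n].

Lemma sub_cylinder (a b r : R) z : 
  [set w | a <= w.1 < b /\ edist z.2 w.2 < r] `<=`
  cylinder a b (r *+ 2) (shift_tuple r z.2).
Proof.
move=> w /= [wab zwr]; split => /=; first by rewrite in_itv.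
move=> i; rewrite tnth_mktuple.
have := le_lt_trans (le_tnth_edist _ _ i) zwr; rewrite ltr_norml => /andP[h1 h2].
by rewrite mulr2n addrA subrK; apply/andP; split; [rewrite ltW|] => //; lra.
Qed.

Local Notation Om := (whitney_region n (1%R, 2%R)).
Implicit Types a b l r : R.

Lemma whitney_volume_ub z : 0 < z.1 ->
  (lebT n (Om z) <= (2 ^+ n.+1 * z.1 ^+ n.+1)%:E)%E.
Proof.
move=> z0; have le20 : 0 <= z.1 *+ 2 by rewrite mulrn_wge0// ltW.
apply: (@le_trans _ _
  (lebT n (cylinder 0 (2 * z.1) (z.1 *+ 2) (shift_tuple z.1 z.2)))).
  apply: le_measure; rewrite ?inE;
    [exact: measurable_whitney_region|exact: measurable_cylinder|].
  move=> w /whitney_regionP/= [zw1 zw2 zw3]; apply: sub_cylinder => /=.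
  rewrite mul1r in zw3; split => //; rewrite zw2 andbT ltW//.
  by apply: lt_trans zw1; rewrite mulr_gt0.
rewrite lebT_cylinder ?subr0//; last by rewrite mulr_ge0// ltW.
by rewrite lee_fin -(mulr_natl z.1) -exprS exprMn.
Qed.

Lemma whitney_volume_lb : exists2 b : R, 0 < b & forall z, 0 < z.1 ->
  ((b * z.1 ^+ n.+1)%:E <= lebT n (Om z))%E.
Proof.
(* Volume of the cylinder with corner [z], height [z.1 / 2] and side [z.1 / n.+1], up to the power
   of [z.1]. With [n.+1] in place of [n] the distance bound [n * l] stays strictly below the radius
   [z.1]. *)
exists (2^-1 * (n.+1%:R^-1) ^+ n); first by rewrite mulr_gt0// exprn_gt0.
move=> z z0; set l := z.1 / n.+1%:R.
have l0 : 0 <= l by rewrite divr_ge0// ltW.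
have -> : (2^-1 * n.+1%:R^-1 ^+ n * z.1 ^+ n.+1)%:E =
    lebT n (cylinder z.1 (3 / 2 * z.1) l z.2).
  rewrite lebT_cylinder//; last lra.
  by rewrite /l exprMn exprS; congr EFin; lra.
apply: le_measure; rewrite ?inE;
  [exact: measurable_cylinder|exact: measurable_whitney_region|].
move=> w [/=]; rewrite in_itv/= => /andP[w1 w2] wb.
apply/whitney_regionP => /=; split; [lra|lra|].
rewrite mul1r; apply: (@le_lt_trans _ _ (n%:R * l)).
  apply: edist_le => // i; have /andP[h1 h2] := wb i.
  by rewrite ler_norml; apply/andP; split; lra.
by rewrite /l mulrCA -[ltRHS]mulr1 ltr_pM2l// ltr_pdivrMr// mul1r ltr_nat.
Qed.

Lemma whitney_volume_fin_num z : 0 < z.1 -> lebT n (Om z) \is a fin_num.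
Proof.
move=> z0; rewrite ge0_fin_numE//.
by apply: le_lt_trans (whitney_volume_ub z0) _; rewrite ltry.
Qed.

(** The height of a common point is comparable both to [z.1] and to [z0.1], so these are comparable;
    the two radii then bound the distance from [z.2] to [z0.2] in each coordinate. *)
Lemma whitney_meet c z0 z : whitney_param c -> 0 < z0.1 -> 0 < z.1 ->
  Om z `&` whitney_region n c z0 !=set0 ->
  cylinder (z0.1 / (2 * c.2)) (2 * c.2 * z0.1)
    (((2 * c.2 + c.1) * z0.1) *+ 2)
    (shift_tuple ((2 * c.2 + c.1) * z0.1) z0.2) z.
Proof.
move=> [c10 c2] z00 zp.
move=> [w [/whitney_regionP/= [h1 h2 h3] /whitney_regionP[k1 k2 k3]]].
have c20 : 0 < c.2 by apply: lt_trans c2; lra.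
have zub : z.1 < 2 * c.2 * z0.1 by lra.
split => /=.
  rewrite in_itv/= zub andbT ltW// invfM mulrA.
  by rewrite mulrC; move: k1; lra.
move=> i; rewrite tnth_mktuple.
have := le_lt_trans (le_tnth_edist _ _ i) h3.
have := le_lt_trans (le_tnth_edist _ _ i) k3.
rewrite !ltr_norml => /andP[a1 a2] /andP[a3 a4].
by apply/andP; split; lra.
Qed.

End whitney_geometry.

(** * Whitney means *)

Section power_subadditivity.
Context {R : realType}.
Implicit Types (a b q : R).

Lemma powR_ge_id a q : 0 <= a <= 1 -> 0 < q <= 1 -> a <= a `^ q.
Proof.
move=> /andP[a0 a1] /andP[q0 q1]; have [->|an0] := eqVneq a 0.
  exact: powR_ge0.
by rewrite -[leLHS]powRr1// ger_powR// a1 lt_neqAle eq_sym an0 a0.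
Qed.

(** Divide by [a + b]: both quotients lie in the unit interval, where a number is at most its power
    of exponent [q], and they add up to 1. *)
Lemma powR_subadditive a b q : 0 <= a -> 0 <= b -> 0 < q <= 1 ->
  (a + b) `^ q <= a `^ q + b `^ q.
Proof.
move=> a0 b0 q01; have [s0|sn0] := eqVneq (a + b) 0.
  by rewrite s0 powR0 ?addr_ge0 ?powR_ge0//; case/andP: q01 => /lt0r_neq0.
have s_gt0 : 0 < a + b by rewrite lt_neqAle eq_sym sn0 addr_ge0.
have aE : a = (a + b) * (a / (a + b)) by rewrite mulrCA divff// mulr1.
have bE : b = (a + b) * (b / (a + b)) by rewrite mulrCA divff// mulr1.
have sge0 := ltW s_gt0.
have as0 : 0 <= a / (a + b) by rewrite divr_ge0.
have bs0 : 0 <= b / (a + b) by rewrite divr_ge0.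
have -> : a `^ q = (a + b) `^ q * (a / (a + b)) `^ q by rewrite -powRM// -aE.
have -> : b `^ q = (a + b) `^ q * (b / (a + b)) `^ q by rewrite -powRM// -bE.
rewrite -mulrDr.
rewrite -[leLHS]mulr1 ler_wpM2l ?powR_ge0//.
apply: (@le_trans _ _ (a / (a + b) + b / (a + b))).
  by rewrite -mulrDl divff.
by apply: lerD; apply: powR_ge_id => //; rewrite ?as0 ?bs0 ler_pdivrMr// mul1r;
  [rewrite lerDl|rewrite lerDr].
Qed.

Local Open Scope ereal_scope.
Implicit Types x y : \bar R.

Lemma poweR_subadditive x y q : 0 <= x -> 0 <= y -> (0 < q <= 1)%R ->
  (x + y) `^ q <= x `^ q + y `^ q.
Proof.
move=> x0 y0 /[dup] q01 /andP[q0 q1]; have qn0 := lt0r_neq0 q0.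
case: x y x0 y0 => [x| |] [y| |]//= x0 y0; rewrite ?(negbTE qn0) ?leey//.
rewrite -EFinD lee_fin; exact: powR_subadditive.
Qed.

Lemma poweR_sum_subadditive (I : Type) (r : seq I) (f : I -> \bar R) q :
  (forall i, 0 <= f i) -> (0 < q <= 1)%R ->
  (\sum_(i <- r) f i) `^ q <= \sum_(i <- r) f i `^ q.
Proof.
move=> f0 q01; elim: r => [|i r ih].
  by rewrite !big_nil poweR0r//; case/andP: q01 => /lt0r_neq0.
rewrite !big_cons; apply: le_trans (poweR_subadditive _ _ q01) _ => //.
  exact: sume_ge0.
exact: leeD2l.
Qed.

Lemma poweR_nneseries_subadditive (f : nat -> \bar R) q :
  (forall i, 0 <= f i) -> (0 < q <= 1)%R ->
  (\sum_(0 <= i <oo) f i) `^ q <= \sum_(0 <= i <oo) f i `^ q.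
Proof.
move=> f0 q01; have /andP[q0 _] := q01.
have S0 : 0 <= \sum_(0 <= i <oo) f i `^ q.
  by apply: nneseries_ge0 => i _ _; exact: poweR_ge0.
(* Raising to [q^-1] turns the claim into a bound on the series itself, hence on its partial sums,
   where the finite case applies. *)
suff : \sum_(0 <= i <oo) f i <= (\sum_(0 <= i <oo) f i `^ q) `^ (q^-1).
  move=> /(@gt0_ler_poweR _ q (ltW q0)) h.
  rewrite -[leRHS]poweRe1// -(mulVf (lt0r_neq0 q0)) poweRrM; apply: h.
    by rewrite in_itv/= leey andbT; exact: nneseries_ge0.
  by rewrite in_itv/= leey andbT poweR_ge0.
apply: lime_le; first exact: is_cvg_nneseries.
apply: nearW => k; rewrite -[leLHS]poweRe1; last exact: sume_ge0.
rewrite -(mulfV (lt0r_neq0 q0)) poweRrM.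
apply: gt0_ler_poweR; rewrite ?invr_ge0 ?(ltW q0)//.
- by rewrite in_itv/= leey andbT poweR_ge0.
- by rewrite in_itv/= leey andbT S0.
apply: le_trans (poweR_sum_subadditive _ f0 q01) _.
by apply: nneseries_lim_ge => i _ _; exact: poweR_ge0.
Qed.

Lemma lee_poweR x y q : (0 <= q)%R -> 0 <= x -> x <= y -> x `^ q <= y `^ q.
Proof.
move=> q0 x0 xy; apply: gt0_ler_poweR => //; rewrite in_itv/= leey andbT//.
exact: le_trans xy.
Qed.

End power_subadditivity.

(** * Means over Whitney regions and the integral of their powers *)

Section whitney_mean.
Context {R : realType}.
Variable n : nat.
Local Notation T := (R * n.-tuple R)%type.
Local Notation Om := (whitney_region n (1%R, 2%R)).
Local Notation U := (@halfspace R n).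
Local Notation mu := (@lebT R n).
Local Open Scope ereal_scope.
Implicit Types (z w : T) (G H : T -> \bar R) (q : R).

Definition wint G z := \int[mu]_(w in Om z) G w.

Definition wmean G z := (fine (mu (Om z)))^-1%:E * wint G z.

(** With [G = dens s f] and [q = p / 2] this is the power [p] of [Znorm]. *)
Definition Zint q G := \int[mu]_(z in U) (wmean G z `^ q * (z.1^-1)%:E).

Let Om_U z : U z -> Om z `<=` U.
Proof. by move=> Uz; apply: whitney_sub_halfspace. Qed.

Let mU : measurable U. Proof. exact: measurable_halfspace. Qed.

Let mOm z : measurable (Om z). Proof. exact: measurable_whitney_region. Qed.

(** Tonelli: [wint G z] is the integral in the second variable of a function measurable on the
    product. *)
Lemma measurable_wint G : measurable_fun U G -> (forall w, U w -> 0 <= G w) ->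
  measurable_fun U (wint G).
Proof.
move=> mG G0.
pose E : set (T * T) := [set p | Om p.1 p.2].
have mE : measurable E by exact: measurable_whitney_graph.
(* Zero extension off [U], because [G] is measurable and non-negative only there. *)
pose F (p : T * T) := (\1_E p)%:E * (G \_ U) p.2.
have GU0 w : 0 <= (G \_ U) w by apply: erestrict_ge0.
have mF : measurable_fun setT F.
  apply: emeasurable_funM; first exact/measurable_EFinP/measurable_indic.
  apply: measurableT_comp => //.
  by move/(measurable_restrictT _ mU) : mG.
have F0 p : 0 <= F p by rewrite mule_ge0// lee_fin.
have h := measurable_fun_fubini_tonelli_F (m2 := mu) F mF F0.
apply: eq_measurable_fun (measurable_funTS h) => z /set_mem Uz.
rewrite /fubini_F /wint [RHS]integral_mkcond; apply: eq_integral => w _.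
rewrite /F /= /patch indicE /E; have [zw|zw] := boolP (w \in Om z).
  rewrite !mem_set//=; last exact: set_mem.
    by rewrite mul1e.
  by apply: (Om_U Uz); exact: set_mem.
rewrite (_ : (z, w) \in _ = false) ?mul0e//; apply/negbTE; move: zw.
by apply: contra => /set_mem zw; exact/mem_set.
Qed.

Lemma measurable_invfst : measurable_fun U (fun z => (z.1^-1)%R).
Proof.
apply: (@eq_measurable_fun _ _ _ _ _ (fun z => z.1 `^ (-1))%R).
  by move=> z /set_mem Uz; rewrite powR_inv1// ltW.
exact: (measurableT_comp (@measurable_powR R _) (measurable_funTS measurable_fst)).
Qed.

Lemma measurable_wmean G : measurable_fun U G -> (forall w, U w -> 0 <= G w) ->
  measurable_fun U (wmean G).
Proof.
move=> mG G0; apply: emeasurable_funM; last exact: measurable_wint.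
apply/measurable_EFinP.
(* The volume is the integral of the constant 1 over the region; its inverse is then the power [-1]
   of a non-negative measurable function. *)
have mV : measurable_fun U (fun z => fine (mu (Om z))).
  apply: (@measurableT_comp _ _ _ _ _ _ (@fine R)); first exact: fine_measurable.
  apply: eq_measurable_fun (measurable_wint (G := cst 1) _ _) => // z _.
  by rewrite /wint integral_cst// mul1e.
apply: (@eq_measurable_fun _ _ _ _ _ (fun z => (fine (mu (Om z))) `^ (-1))%R).
  by move=> z /set_mem Uz; rewrite powR_inv1// fine_ge0.
exact: (measurableT_comp (@measurable_powR R _) mV).
Qed.

Lemma wint_ge0 G z : (forall w, U w -> 0 <= G w) -> U z -> 0 <= wint G z.
Proof. by move=> G0 Uz; apply: integral_ge0 => w /(Om_U Uz)/G0. Qed.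

Lemma wmean_ge0 G z : (forall w, U w -> 0 <= G w) -> U z -> 0 <= wmean G z.
Proof.
by move=> G0 Uz; rewrite mule_ge0 ?wint_ge0// lee_fin invr_ge0 fine_ge0.
Qed.

Lemma whitney_volume_inv_gt0 z : U z -> 0 < (fine (mu (Om z)))^-1%:E.
Proof.
move=> Uz; rewrite lte_fin invr_gt0 fine_gt0//.
have [b b0 bV] := whitney_volume_lb (R := R) n.
rewrite (lt_le_trans _ (bV z Uz)) ?lte_fin ?mulr_gt0 ?exprn_gt0//=.
by rewrite -ge0_fin_numE// whitney_volume_fin_num.
Qed.

Lemma le_wint G H z : measurable_fun U G -> measurable_fun U H ->
  (forall w, U w -> 0 <= G w) -> (forall w, U w -> G w <= H w) -> U z ->
  wint G z <= wint H z.
Proof.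
move=> mG mH G0 GH Uz; apply: ge0_le_integral => //.
- by move=> w /(Om_U Uz)/G0.
- exact: measurable_funS (Om_U Uz) mG.
- exact: measurable_funS (Om_U Uz) mH.
- by move=> w /(Om_U Uz)/GH.
Qed.

Lemma measurable_Zint_fun q G : measurable_fun U G ->
  (forall w, U w -> 0 <= G w) ->
  measurable_fun U (fun z => wmean G z `^ q * (z.1^-1)%:E).
Proof.
move=> mG G0; apply: emeasurable_funM.
  exact: (measurableT_comp (@measurable_poweR R q) (measurable_wmean mG G0)).
by apply/measurable_EFinP; exact: measurable_invfst.
Qed.

Lemma Zint_fun_ge0 q G z : U z -> 0 <= wmean G z `^ q * (z.1^-1)%:E.
Proof. by move=> Uz; rewrite mule_ge0 ?poweR_ge0// lee_fin invr_ge0 ltW. Qed.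

Lemma Zint_ge0 q G : 0 <= Zint q G.
Proof. by apply: integral_ge0 => z; exact: Zint_fun_ge0. Qed.

Lemma le_Zint q G H : (0 <= q)%R -> measurable_fun U G -> measurable_fun U H ->
  (forall w, U w -> 0 <= G w) -> (forall w, U w -> G w <= H w) ->
  Zint q G <= Zint q H.
Proof.
move=> q0 mG mH G0 GH.
have H0 w : U w -> 0 <= H w by move=> Uw; exact: le_trans (G0 _ Uw) (GH _ Uw).
apply: ge0_le_integral => //.
- by move=> z; exact: Zint_fun_ge0.
- exact: measurable_Zint_fun.
- exact: measurable_Zint_fun.
- move=> z Uz; apply: lee_wpmul2r; first by rewrite lee_fin invr_ge0 ltW.
  apply: lee_poweR => //; first exact: wmean_ge0.
  by apply: lee_wpmul2l; [exact/ltW/whitney_volume_inv_gt0|exact: le_wint].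
Qed.

(** Monotone convergence moves the series out of the mean and out of the outer integral; in between,
    the power [q <= 1] is countably subadditive at each [z]. *)
Lemma Zint_nneseries q (G : nat -> T -> \bar R) : (0 < q <= 1)%R ->
  (forall k, measurable_fun U (G k)) -> (forall k w, U w -> 0 <= G k w) ->
  Zint q (fun w => \sum_(0 <= k <oo) G k w) <= \sum_(0 <= k <oo) Zint q (G k).
Proof.
move=> q01 mG G0.
have S0 w : U w -> 0 <= \sum_(0 <= k <oo) G k w.
  by move=> Uw; apply: nneseries_ge0 => k _ _; exact: G0.
have mS : measurable_fun U (fun w => \sum_(0 <= k <oo) G k w).
  by apply: ge0_emeasurable_sum => // k w Uw _; exact: G0.
rewrite /Zint -integral_nneseries//; last 2 first.
- by move=> k; exact: (measurable_Zint_fun q (mG k) (G0 k)).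
- by move=> k z; exact: Zint_fun_ge0.
apply: ge0_le_integral => //.
- by move=> z; exact: Zint_fun_ge0.
- exact: measurable_Zint_fun.
- apply: ge0_emeasurable_sum => [k z Uz _|k _]; first exact: Zint_fun_ge0.
  exact: (measurable_Zint_fun q (mG k) (G0 k)).
move=> z Uz; have i0 : (0 <= z.1^-1)%R by rewrite invr_ge0 ltW.
have -> : wmean (fun w => \sum_(0 <= k <oo) G k w) z =
    \sum_(0 <= k <oo) wmean (G k) z.
  rewrite nneseriesZl; last by move=> k _; exact: (wint_ge0 (G0 k) Uz).
  congr (_ * _); apply: integral_nneseries => //.
  - by move=> k; exact: measurable_funS (Om_U Uz) (mG k).
  - by move=> k w /(Om_U Uz) Uw; exact: G0.
have -> : \sum_(0 <= k <oo) (wmean (G k) z `^ q * (z.1^-1)%:E) =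
    \sum_(0 <= k <oo) ((z.1^-1)%:E * wmean (G k) z `^ q).
  by apply: eq_eseriesr => k _; rewrite muleC.
rewrite [leRHS]nneseriesZl; last by move=> k _; exact: poweR_ge0.
rewrite muleC; apply: lee_wpmul2l => //.
by apply: poweR_nneseries_subadditive => // k; exact: (wmean_ge0 (G0 k) Uz).
Qed.

End whitney_mean.

(** * Upper bound for localised densities and lower bound on a cell *)

Section whitney_bounds.
Context {R : realType}.
Variable n : nat.
Local Notation T := (R * n.-tuple R)%type.
Local Notation Om := (whitney_region n (1%R, 2%R)).
Local Notation U := (@halfspace R n).
Local Notation mu := (@lebT R n).
Local Open Scope ereal_scope.
Implicit Types (z w : T) (G H : T -> \bar R) (q : R).

Let Om_U z : U z -> Om z `<=` U.
Proof. by move=> Uz; apply: whitney_sub_halfspace. Qed.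

Let mU : measurable U. Proof. exact: measurable_halfspace. Qed.

Let mOm z : measurable (Om z). Proof. exact: measurable_whitney_region. Qed.

(** Splits the scaling factor into a volume [t ^+ n] and the power [q] of the [t ^- n] that appears
    in the means. *)
Lemma powR_dim (t q : R) : (0 < t)%R ->
  (t `^ (n%:R * (1 - q)) = t ^+ n * ((t ^+ n)^-1) `^ q)%R.
Proof.
move=> t0; rewrite mulrBr mulr1 -mulNr powRD; last first.
  by apply/implyP => _; rewrite gt_eqF.
by rewrite powR_mulrn ?ltW// powRrM powR_invn// ltW.
Qed.

(** The support condition holds only up to a null set, as for atoms; this set is removed first, and
    outside it [G] agrees on [U] with its restriction to the region. *)
Lemma wint_le_support (c : R * R) (z0 z : T) G : (0 < c.2)%R -> U z0 -> U z ->
  measurable_fun U G -> (forall w, U w -> 0 <= G w) ->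
  mu.-negligible [set w | [/\ U w, ~ whitney_region n c z0 w & G w != 0]] ->
  wint G z <= \int[mu]_(w in Om z `&` whitney_region n c z0) G w.
Proof.
move=> c0 Uz0 Uz mG G0 [N [mN N0 NG]].
have mc : measurable (whitney_region n c z0).
  exact: measurable_whitney_region.
have mGz := measurable_funS mU (Om_U Uz) mG.
rewrite /wint (ge0_negligible_integral _ _ mGz _ N0)//; last first.
  by move=> w /(Om_U Uz)/G0.
rewrite (eq_integral (G \_ (whitney_region n c z0))); last first.
  move=> w /set_mem[/(Om_U Uz) Uw Nw]; rewrite patchE; case: ifPn => // cw.
  apply: contrapT => /eqP Gw; apply: Nw; apply: NG; split => //.
  by move/mem_set; rewrite (negbTE cw).
rewrite [leRHS]integral_mkcondr; apply: ge0_subset_integral => //.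
- exact: measurableD.
- apply/(measurable_restrict _ mc (mOm z)).
  by apply: measurable_funS mGz => //; exact: subIsetl.
- by move=> w zw; rewrite patchE; case: ifPn => // _; apply/G0/(Om_U Uz).
Qed.

Lemma ge0_le_integral_cst (D : set T) (f : T -> \bar R) (M : \bar R) :
  measurable D -> measurable_fun D f -> 0 <= M -> (forall z, D z -> M <= f z) ->
  M * mu D <= \int[mu]_(z in D) f z.
Proof.
move=> mD mf M0 Mf; rewrite -integral_cst//; apply: ge0_le_integral => //.
Qed.

Lemma Zint_atom (c : R * R) q : whitney_param c -> (0 < q)%R ->
  exists2 C : R, (0 < C)%R & forall z0 G, U z0 -> measurable_fun U G ->
    (forall w, U w -> 0 <= G w) ->
    mu.-negligible [set w | [/\ U w, ~ whitney_region n c z0 w & G w != 0]] ->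
  Zint q G <= (C * z0.1 `^ (n%:R * (1 - q)))%:E *
    (\int[mu]_(w in whitney_region n c z0) (G w * (w.1^-1)%:E)) `^ q.
Proof.
move=> cW q0; have [c10 c2] := cW.
have c20 : (0 < c.2)%R by apply: lt_trans c2; rewrite divr_gt0.
have [b b0 bV] := whitney_volume_lb (R := R) n.
(* [d] bounds the ratio of the heights of [z] and [z0] when their regions meet; [K / z0.1 ^+ n] will
   bound the means, and [l * z0.1] is the side of the cylinder containing all such [z]. *)
pose d := (2 * c.2)%R; have d0 : (0 < d)%R by rewrite mulr_gt0.
pose K := (d ^+ n.+1 * c.2 / b)%R.
have K0 : (0 < K)%R by rewrite divr_gt0// mulr_gt0// exprn_gt0.
pose l := (2 * (d + c.1))%R; have l0 : (0 < l)%R by rewrite mulr_gt0// addr_gt0.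
(* [K] comes from the means; one factor [d] comes from [1 / z.1 <= d / z0.1], the other from the
   height [d * z0.1] of the cylinder, and [l ^+ n] from its base. *)
exists (K `^ q * d ^+ 2 * l ^+ n)%R.
  by rewrite !mulr_gt0 ?powR_gt0 ?exprn_gt0.
move=> z0 G Uz0 mG G0 neg; set A := \int[mu]_(w in _) _.
have z0_gt0 : (0 < z0.1)%R := Uz0.
have tn0 : (0 < z0.1 ^+ n)%R by rewrite exprn_gt0.
have mc : measurable (whitney_region n c z0).
  exact: measurable_whitney_region.
have cU : whitney_region n c z0 `<=` U by apply: whitney_sub_halfspace.
have mGi : measurable_fun U (fun w => G w * (w.1^-1)%:E).
  apply: emeasurable_funM => //.
  by apply/measurable_EFinP; exact: measurable_invfst.
have Gi0 w : U w -> 0 <= G w * (w.1^-1)%:E.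
  by move=> Uw; rewrite mule_ge0 ?G0// lee_fin invr_ge0 ltW.
have A0 : 0 <= A by apply: integral_ge0 => w /cU; exact: Gi0.
(* On the region [w.1 < c.2 * z0.1], which is the cost of inserting the weight [1 / w.1]. *)
have intG : \int[mu]_(w in whitney_region n c z0) G w <= (c.2 * z0.1)%:E * A.
  rewrite -ge0_integralZl_EFin//; last first.
  - by rewrite mulr_ge0 ?ltW.
  - exact: measurable_funS cU mGi.
  - by move=> w /cU; exact: Gi0.
  apply: ge0_le_integral => //.
  - by move=> w /cU; exact: G0.
  - exact: measurable_funS cU mG.
  - by apply: measurable_funeM; exact: measurable_funS cU mGi.
  move=> w cw; have w0 : (0 < w.1)%R := cU _ cw.
  have /whitney_regionP[_ wc _] := cw.
  rewrite muleCA -EFinM -[leLHS]mule1; apply: lee_wpmul2l; first exact/G0/cU.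
  by rewrite lee_fin ler_pdivlMr// mul1r ltW.
pose cyl := cylinder (z0.1 / d) (d * z0.1) (((d + c.1) * z0.1) *+ 2)
    (shift_tuple ((d + c.1) * z0.1) z0.2).
have wmean_cyl z : U z -> cyl z -> wmean G z <= (K / z0.1 ^+ n)%:E * A.
  move=> Uz [+ _]; rewrite /= in_itv/= => /andP[dz _].
  have z0' : (0 < z.1)%R := Uz.
  apply: (@le_trans _ _ ((b * z.1 ^+ n.+1)^-1%:E * ((c.2 * z0.1)%:E * A))).
    apply: lee_pmul.
    - exact/ltW/whitney_volume_inv_gt0.
    - exact: wint_ge0.
    - rewrite lee_fin lef_pV2 ?posrE ?mulr_gt0 ?exprn_gt0//.
        by rewrite -lee_fin fineK ?bV// whitney_volume_fin_num.
      by rewrite -invr_gt0 -lte_fin; exact: whitney_volume_inv_gt0.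
    - apply: le_trans (wint_le_support c20 Uz0 Uz mG G0 neg) _.
      apply: le_trans intG; apply: ge0_subset_integral => //.
      + exact: measurableI.
      + exact: measurable_funS cU mG.
      + by move=> w /cU; exact: G0.
  rewrite muleA -EFinM; apply: lee_wpmul2r => //; rewrite lee_fin.
  rewrite mulrC ler_pdivrMr ?mulr_gt0 ?exprn_gt0//.
  apply: (@le_trans _ _ (K / z0.1 ^+ n * (b * (z0.1 / d) ^+ n.+1))%R); last first.
    apply: ler_wpM2l; first by rewrite divr_ge0// ltW.
    apply: ler_wpM2l; first exact: ltW.
    by rewrite lerXn2r ?nnegrE ?divr_ge0// ltW.
  rewrite le_eqVlt; apply/orP; left; apply/eqP.
  rewrite /K expr_div_n !exprS.
  have dn0 : (d ^+ n != 0)%R by rewrite gt_eqF// exprn_gt0.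
  by field; rewrite ?dn0 !gt_eqF.
have wmean_out z : U z -> ~ cyl z -> wmean G z = 0.
  move=> Uz ncyl; apply/eqP; rewrite eq_le wmean_ge0// andbT.
  rewrite -[leRHS](mule0 (fine (mu (Om z)))^-1%:E); apply: lee_wpmul2l.
    exact/ltW/whitney_volume_inv_gt0.
  apply: le_trans (wint_le_support c20 Uz0 Uz mG G0 neg) _.
  rewrite [X in integral _ X _](_ : _ = set0) ?integral_set0//.
  apply/eqP/negPn/negP => /set0P h; apply: ncyl.
  exact: whitney_meet.
(* An upper bound for the integrand of [Zint] on the cylinder, outside which the mean vanishes. *)
pose M := ((K / z0.1 ^+ n) `^ q * (d / z0.1))%:E * A `^ q.
have M0 : 0 <= M.
  by rewrite mule_ge0 ?poweR_ge0// lee_fin mulr_ge0 ?powR_ge0// divr_ge0 ?ltW.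
have mcyl : measurable cyl by exact: measurable_cylinder.
apply: (@le_trans _ _ (\int[mu]_(z in U) (M * (\1_cyl z)%:E))).
  apply: ge0_le_integral => //.
  - by move=> z; exact: Zint_fun_ge0.
  - exact: measurable_Zint_fun.
  - by apply: measurable_funeM; apply/measurable_EFinP; exact: measurable_indic.
  move=> z Uz; have z_gt0 : (0 < z.1)%R := Uz.
  have [cz|ncz] := pselect (cyl z); last first.
    by rewrite wmean_out// poweR0r ?gt_eqF// mul0e indicE memNset// mule0.
  rewrite indicE mem_set// mule1 /M EFinM muleAC; apply: lee_pmul.
  - exact: poweR_ge0.
  - by rewrite lee_fin invr_ge0 ltW.
  - rewrite -poweR_EFin -poweRM//; last by rewrite lee_fin divr_ge0 ?ltW.
    by apply: lee_poweR; [exact: ltW|exact: wmean_ge0|exact: wmean_cyl].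
  - rewrite lee_fin -[leRHS]invrK invf_div lef_pV2 ?posrE ?divr_gt0//.
    by case: cz => /=; rewrite in_itv/= => /andP[].
rewrite ge0_integralZl//; last first.
  by apply/measurable_EFinP; exact: measurable_indic.
rewrite integral_indic//; apply: (@le_trans _ _ (M * mu cyl)).
  by apply: lee_wpmul2l => //; apply: le_measure; rewrite ?inE//; exact: measurableI.
have cylE : (((d + c.1) * z0.1) *+ 2 = l * z0.1)%R by rewrite /l -mulr_natl mulrA.
rewrite lebT_cylinder; last 2 first.
- apply: (@le_trans _ _ z0.1).
    rewrite ler_pdivrMr// ler_peMr ?ltW// /d; lra.
  rewrite ler_peMl ?ltW// /d; lra.
- by rewrite cylE mulr_ge0 ?ltW.
rewrite /M muleAC -EFinM; apply: lee_wpmul2r; first exact: poweR_ge0.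
rewrite cylE lee_fin powR_dim// powRM; last 2 first.
- exact: ltW.
- by rewrite invr_ge0 ltW.
(* The height [d * z0.1 - z0.1 / d] is enlarged to [d * z0.1], after which the powers of [z0.1]
   match. *)
apply: (@le_trans _ _ (K `^ q * (z0.1 ^- n) `^ q * (d / z0.1) *
    (d * z0.1 * (l * z0.1) ^+ n))%R).
  apply: ler_wpM2l.
    by rewrite !mulr_ge0 ?powR_ge0 ?invr_ge0 ?ltW.
  apply: ler_wpM2r; first by rewrite exprn_ge0// mulr_ge0 ?ltW.
  by rewrite gerBl divr_ge0 ?ltW.
rewrite le_eqVlt; apply/orP; left; apply/eqP; rewrite exprMn.
by field; rewrite gt_eqF.
Qed.

(** The region of any point of [Q] contains [Q] and has volume at most [(3 * t) ^+ n.+1], which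
    bounds all these means from below by one constant; integrating it over [Q] gains the volume of
    [Q]. The choice of [C] depends on the cells only through [r], so it serves all of them at
    once. *)
Lemma Zint_cell (q r : R) : (0 < q)%R -> (0 < r)%R ->
  exists2 C : R, (0 < C)%R & forall (t : R) (Q : set T) G, (0 < t)%R ->
    measurable Q -> Q `<=` U ->
    (forall z, Q z -> (t <= z.1 <= 3 / 2 * t)%R) ->
    (forall z, Q z -> Q `<=` Om z) ->
    (r * t ^+ n.+1)%:E <= mu Q ->
    measurable_fun U G -> (forall w, U w -> 0 <= G w) ->
  (t `^ (n%:R * (1 - q)))%:E * (\int[mu]_(w in Q) (G w * (w.1^-1)%:E)) `^ q
  <= C%:E * \int[mu]_(z in Q) (wmean G z `^ q * (z.1^-1)%:E).
Proof.
(* [3 ^+ n.+1] comes from the volume of the regions, [2 / 3] from [1 / z.1 >= 2 / (3 * t)], and [r]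
   from the volume of [Q]. *)
move=> q0 r0; pose e : R := ((3 ^+ n.+1)^-1 `^ q * (2 / 3) * r)%R.
have e0 : (0 < e)%R.
  by rewrite !mulr_gt0 ?powR_gt0 ?invr_gt0 ?exprn_gt0.
exists (e^-1)%R; first by rewrite invr_gt0.
move=> t Q G t0 mQ QU Qt QOm muQ mG G0; set A := \int[mu]_(w in Q) _.
have tn0 : (0 < t ^+ n)%R by rewrite exprn_gt0.
have mGi : measurable_fun U (fun w => G w * (w.1^-1)%:E).
  apply: emeasurable_funM => //.
  by apply/measurable_EFinP; exact: measurable_invfst.
have Gi0 w : U w -> 0 <= G w * (w.1^-1)%:E.
  by move=> Uw; rewrite mule_ge0 ?G0// lee_fin invr_ge0 ltW.
have A0 : 0 <= A by apply: integral_ge0 => w /QU; exact: Gi0.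
have tA z : Q z -> t%:E * A <= wint G z.
  move=> Qz; apply: (@le_trans _ _ (\int[mu]_(w in Q) G w)); last first.
    apply: ge0_subset_integral => //.
    - exact: measurable_funS (Om_U (QU _ Qz)) mG.
    - by move=> w /(Om_U (QU _ Qz)); exact: G0.
    - exact: QOm.
  rewrite -ge0_integralZl_EFin//; last first.
  - exact: ltW.
  - exact: measurable_funS QU mGi.
  - by move=> w /QU; exact: Gi0.
  apply: ge0_le_integral => //.
  - by move=> w /QU Uw; rewrite mule_ge0 ?Gi0// lee_fin ltW.
  - by apply: measurable_funeM; exact: measurable_funS QU mGi.
  - exact: measurable_funS QU mG.
  move=> w Qw; have w0 : (0 < w.1)%R := QU _ Qw.
  rewrite muleCA -EFinM -[leRHS]mule1; apply: lee_wpmul2l; first exact/G0/QU.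
  by rewrite lee_fin ler_pdivrMr// mul1r; case/andP: (Qt _ Qw).
have mean_ge z : Q z -> (3 ^+ n.+1 * t ^+ n)^-1%:E * A <= wmean G z.
  move=> Qz; have Uz := QU _ Qz; have z0 : (0 < z.1)%R := Uz.
  have -> : ((3 ^+ n.+1 * t ^+ n)^-1 = (3 ^+ n.+1 * t ^+ n.+1)^-1 * t :> R)%R.
    by rewrite [(t ^+ n.+1)%R]exprS; field; rewrite !gt_eqF// exprn_gt0.
  rewrite EFinM -muleA; apply: lee_pmul.
  - by rewrite lee_fin invr_ge0 mulr_ge0 ?exprn_ge0 ?ltW.
  - by rewrite mule_ge0// lee_fin ltW.
  - have V0 := whitney_volume_inv_gt0 Uz.
    rewrite lee_fin lef_pV2 ?posrE ?mulr_gt0 ?exprn_gt0//; last first.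
      by rewrite -invr_gt0 -lte_fin.
    rewrite -lee_fin fineK ?whitney_volume_fin_num//.
    apply: le_trans (whitney_volume_ub z0) _; rewrite lee_fin -!exprMn.
    have /andP[_ zt] := Qt _ Qz.
    apply: lerXn2r; rewrite ?nnegrE; [by rewrite mulr_ge0// ltW..|lra].
  - exact: tA.
pose M := ((3 ^+ n.+1 * t ^+ n)^-1 `^ q * (2 / 3 / t))%:E * A `^ q.
have M0 : 0 <= M.
  by rewrite mule_ge0 ?poweR_ge0// lee_fin !mulr_ge0 ?powR_ge0// invr_ge0 ltW.
apply: (@le_trans _ _ ((e^-1)%:E * (M * mu Q))); last first.
  apply: lee_wpmul2l; first by rewrite lee_fin invr_ge0 ltW.
  apply: ge0_le_integral_cst => //.
    exact: measurable_funS QU (measurable_Zint_fun q mG G0).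
  move=> z Qz; have Uz := QU _ Qz; have z0 : (0 < z.1)%R := Uz.
  rewrite /M EFinM muleAC; apply: lee_pmul.
  - by rewrite mule_ge0 ?poweR_ge0// lee_fin powR_ge0.
  - by rewrite lee_fin mulr_ge0// invr_ge0 ltW.
  - have i0 : (0 <= (3 ^+ n.+1 * t ^+ n)^-1 :> R)%R.
      by rewrite invr_ge0 mulr_ge0 ?exprn_ge0 ?ltW.
    rewrite -poweR_EFin -poweRM//.
    apply: lee_poweR; [exact: ltW|exact: mule_ge0|exact: mean_ge].
  - rewrite lee_fin ler_pdivrMr// [leRHS]mulrC ler_pdivlMr//.
    have /andP[_ zt] := Qt _ Qz; lra.
apply: (@le_trans _ _ ((e^-1)%:E * (M * (r * t ^+ n.+1)%:E))); last first.
  apply: lee_wpmul2l; first by rewrite lee_fin invr_ge0 ltW.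
  exact: lee_wpmul2l.
rewrite /M muleAC muleA -!EFinM; apply: lee_wpmul2r; first exact: poweR_ge0.
rewrite lee_fin powR_dim// [((3 ^+ n.+1 * t ^+ n)^-1)%R]invfM.
rewrite powRM; last 2 first.
- by rewrite invr_ge0 exprn_ge0.
- by rewrite invr_ge0 ltW.
rewrite le_eqVlt; apply/orP; left; apply/eqP.
rewrite /e [(t ^+ n.+1)%R]exprS.
have p0 : ((3 ^+ n.+1)^-1 `^ q != 0 :> R)%R.
  by rewrite gt_eqF// powR_gt0 invr_gt0 exprn_gt0.
by field; rewrite p0 !gt_eqF.
Qed.

End whitney_bounds.

(** * Vector-valued functions *)

Section vector_norm.
Context {R : realType}.
Implicit Types (x y : R[i]).

Lemma cabs2_ge0 x : 0 <= cabs2 x.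
Proof. by rewrite addr_ge0// sqr_ge0. Qed.

Lemma cabs2M x y : cabs2 (x * y) = cabs2 x * cabs2 y.
Proof. by case: x => a b; case: y => d e; rewrite /cabs2/=; ring. Qed.

Lemma cabs2_real (r : R) : cabs2 (r%:C)%C = r ^+ 2.
Proof. by rewrite /cabs2/=; ring. Qed.

Lemma cabs2_0 : cabs2 0 = 0 :> R.
Proof. by rewrite /cabs2/=; ring. Qed.

(** For real and imaginary parts separately, the difference of the two sides is a square divided by
    [e]. Being linear in the squares, this weighted form survives integration; optimising in [e]
    afterwards yields the triangle inequality. *)
Lemma cabs2D_le x y e : 0 < e ->
  cabs2 (x + y) <= (1 + e) * cabs2 x + (1 + e^-1) * cabs2 y.
Proof.
move=> e0.
have sq (a b : R) : (a + b) ^+ 2 <= (1 + e) * a ^+ 2 + (1 + e^-1) * b ^+ 2.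
  rewrite -subr_ge0 (_ : _ - _ = e^-1 * (e * a - b) ^+ 2).
    by rewrite mulr_ge0 ?sqr_ge0// invr_ge0 ltW.
  by field; rewrite gt_eqF.
case: x => a b; case: y => d f; rewrite /cabs2/= !mulrDr addrACA.
exact: lerD.
Qed.

Variable N : nat.
Implicit Types (u v : 'rV[R[i]]_N).

Lemma vnorm2_ge0 v : 0 <= vnorm2 v.
Proof. by apply: sumr_ge0 => j _; exact: cabs2_ge0. Qed.

Lemma vnorm2Z x v : vnorm2 (x *: v) = cabs2 x * vnorm2 v.
Proof. by rewrite /vnorm2 mulr_sumr; apply: eq_bigr => j _; rewrite mxE cabs2M. Qed.

Lemma vnorm2_0 : vnorm2 (0 : 'rV[R[i]]_N) = 0.
Proof. by rewrite /vnorm2 big1// => j _; rewrite mxE cabs2_0. Qed.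

Lemma vnorm2D_le u v e : 0 < e ->
  vnorm2 (u + v) <= (1 + e) * vnorm2 u + (1 + e^-1) * vnorm2 v.
Proof.
move=> e0; rewrite /vnorm2 !mulr_sumr -big_split/=; apply: ler_sum => j _.
by rewrite mxE; exact: cabs2D_le.
Qed.

End vector_norm.

(** * Minkowski's inequality from weighted quadratic bounds *)

Section minkowski_sqrt.
Context {R : realType}.

(* Choosing e = (sqrt b + d) / (sqrt a + d) and letting d -> 0 recovers
   Minkowski's inequality from its quadratic weighted form. *)
Lemma sqrt_le_weighted (x a b : R) : 0 <= x -> 0 <= a -> 0 <= b ->
  (forall e, 0 < e -> x <= (1 + e) * a + (1 + e^-1) * b) ->
  Num.sqrt x <= Num.sqrt a + Num.sqrt b.
Proof.
move=> x0 a0 b0 xab.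
set A := Num.sqrt a; set B := Num.sqrt b.
have A0 : 0 <= A := sqrtr_ge0 _; have B0 : 0 <= B := sqrtr_ge0 _.
have aE : a = A ^+ 2 by rewrite sqr_sqrtr.
have bE : b = B ^+ 2 by rewrite sqr_sqrtr.
rewrite -[leRHS]ger0_norm ?addr_ge0// -sqrtr_sqr ler_wsqrtr//.
apply/ler_addgt0Pr => eps eps0.
(* This size makes [d * (A + B)] at most [eps]; a positive [d] also keeps the denominators away from
   zero when [a] or [b] vanishes. *)
pose d := eps / (A + B + 1); have d0 : 0 < d.
  by rewrite divr_gt0// ltr_wpDl ?addr_ge0.
have Ad : 0 < A + d by exact: ltr_wpDl.
have Bd : 0 < B + d by exact: ltr_wpDl.
have e0 : 0 < (B + d) / (A + d) by exact: divr_gt0.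
apply: le_trans (xab _ e0) _.
have h1 : A ^+ 2 / (A + d) <= A.
  by rewrite ler_pdivrMr// expr2 ler_wpM2l// lerDl ltW.
have h2 : B ^+ 2 / (B + d) <= B.
  by rewrite ler_pdivrMr// expr2 ler_wpM2l// lerDl ltW.
have -> : (1 + (B + d) / (A + d)) * a + (1 + ((B + d) / (A + d))^-1) * b =
    A ^+ 2 + B ^+ 2 + (B + d) * (A ^+ 2 / (A + d)) + (A + d) * (B ^+ 2 / (B + d)).
  by rewrite aE bE; field; rewrite !gt_eqF.
have h3 : (B + d) * (A ^+ 2 / (A + d)) <= (B + d) * A by rewrite ler_wpM2l// ltW.
have h4 : (A + d) * (B ^+ 2 / (B + d)) <= (A + d) * B by rewrite ler_wpM2l// ltW.
have h5 : d * (A + B) <= eps.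
  rewrite /d mulrAC ler_pdivrMr ?ltr_wpDl ?addr_ge0//.
  by rewrite ler_wpM2l ?lerDl// ltW.
nra.
Qed.

Local Open Scope ereal_scope.

Lemma poweR_half_le_weighted (x a b : \bar R) : 0 <= x -> 0 <= a -> 0 <= b ->
  (forall e : R, (0 < e)%R -> x <= (1 + e)%:E * a + (1 + e^-1)%:E * b) ->
  x `^ 2^-1 <= a `^ 2^-1 + b `^ 2^-1.
Proof.
have h0 : (2^-1 != 0 :> R)%R by [].
case: a => [a| |]//; last first.
  by rewrite poweRyr// addye ?leey// gt_eqF// (lt_le_trans ltNy0)// poweR_ge0.
case: b => [b| |]//; last by move=> *; rewrite (@poweRyr R)// addey ?leey.
move=> x0 a0 b0 xab.
(* For finite [a] and [b] the hypothesis at [e = 1] makes [x] finite. *)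
have x_fin : x \is a fin_num.
  by rewrite ge0_fin_numE//; apply: le_lt_trans (xab _ ltr01) _; rewrite ltry.
move: x x_fin x0 xab => [x| |]// _ x0 xab; rewrite !poweR_EFin -EFinD lee_fin.
by rewrite !powR12_sqrt//; exact: sqrt_le_weighted.
Qed.

End minkowski_sqrt.

(** * Measurability and subadditivity in terms of the squared density *)

Section density.
Context {R : realType}.
Variables (n N : nat) (s : R).
Local Notation T := (R * n.-tuple R)%type.
Local Notation Om := (whitney_region n (1%R, 2%R)).
Local Notation U := (@halfspace R n).
Local Notation mu := (@lebT R n).
Implicit Types (z w : T) (f g : vfun R n N).

Let Om_U z : U z -> Om z `<=` U.
Proof. by move=> Uz; apply: whitney_sub_halfspace. Qed.

Let mU : measurable U. Proof. exact: measurable_halfspace. Qed.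

Let mOm z : measurable (Om z). Proof. exact: measurable_whitney_region. Qed.

Lemma L0_add f g : L0 f -> L0 g -> L0 (fun w => f w + g w).
Proof.
move=> mf mg j; have [f1 f2] := mf j; have [g1 g2] := mg j; split.
  rewrite [X in measurable_fun _ X](_ : _ =
    (fun z => complex.Re (f z ord0 j)) \+ (fun z => complex.Re (g z ord0 j))).
    exact: measurable_funD.
  by apply/funext => z /=; rewrite mxE; case: (f z ord0 j); case: (g z ord0 j).
rewrite [X in measurable_fun _ X](_ : _ =
  (fun z => complex.Im (f z ord0 j)) \+ (fun z => complex.Im (g z ord0 j))).
  exact: measurable_funD.
by apply/funext => z /=; rewrite mxE; case: (f z ord0 j); case: (g z ord0 j).
Qed.

Lemma L0_scale (x : R[i]) f : L0 f -> L0 (fun w => x *: f w).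
Proof.
move=> mf j; have [f1 f2] := mf j; case: x => a b; split.
  rewrite [X in measurable_fun _ X](_ : _ =
    (fun z => a * complex.Re (f z ord0 j)) \-
    (fun z => b * complex.Im (f z ord0 j))).
    by apply: measurable_funB; exact: measurable_funM.
  by apply/funext => z /=; rewrite mxE; case: (f z ord0 j).
rewrite [X in measurable_fun _ X](_ : _ =
  (fun z => a * complex.Im (f z ord0 j)) \+
  (fun z => b * complex.Re (f z ord0 j))).
  by apply: measurable_funD; exact: measurable_funM.
by apply/funext => z /=; rewrite mxE; case: (f z ord0 j) => //= d e; ring.
Qed.

Lemma L0_sum (a : nat -> vfun R n N) (lam : nat -> R[i]) m :
  (forall k, L0 (a k)) -> L0 (fun w => \sum_(k < m) lam k *: a k w).
Proof.
move=> ma; elim: m => [|m ih].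
  move=> j; split.
    rewrite [X in measurable_fun _ X](_ : _ = cst 0)//.
    by apply/funext => z; rewrite big_ord0 mxE.
  rewrite [X in measurable_fun _ X](_ : _ = cst 0)//.
  by apply/funext => z; rewrite big_ord0 mxE.
rewrite (_ : (fun w => _) = fun w => \sum_(k < m) lam k *: a k w + lam m *: a m w).
  exact: L0_add (L0_scale _ (ma m)).
by apply/funext => w; rewrite big_ord_recr.
Qed.

Lemma L0_sub_sum f (a : nat -> vfun R n N) (lam : nat -> R[i]) m :
  L0 f -> (forall k, L0 (a k)) ->
  L0 (fun w => f w - \sum_(k < m) lam k *: a k w).
Proof.
move=> mf ma; rewrite (_ : (fun w => _) =
    fun w => f w + (-1) *: (\sum_(k < m) lam k *: a k w)).
  exact: L0_add (L0_scale _ (L0_sum _ _ _)).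
by apply/funext => w; rewrite scaleN1r.
Qed.

Lemma L0_restrict (Q : set T) f : measurable Q -> L0 f ->
  L0 (fun w => if w \in Q then f w else 0).
Proof.
move=> mQ mf j; have [f1 f2] := mf j.
have aux (h : T -> R) : measurable_fun U h ->
    measurable_fun U (fun z => if z \in Q then h z else 0).
  move=> mh; rewrite [X in measurable_fun _ X](_ : _ = fun z => h z * \1_Q z).
    by apply: measurable_funM => //; exact: measurable_indic.
  by apply/funext => z; rewrite indicE; case: ifPn; rewrite ?mulr1 ?mulr0.
by split; [apply: eq_measurable_fun (aux _ f1)|apply: eq_measurable_fun (aux _ f2)];
  move=> z _; case: ifPn => //; rewrite mxE.
Qed.

Definition dens f w : \bar R := (vnorm2 (kappa s f w))%:E.

Lemma densE f w : dens f w = ((w.1 `^ (- s)) ^+ 2 * vnorm2 (f w))%:E.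
Proof. by rewrite /dens vnorm2Z cabs2_real. Qed.

Lemma dens_ge0 f w : (0 <= dens f w)%E.
Proof. by rewrite lee_fin vnorm2_ge0. Qed.

Lemma measurable_dens f : L0 f -> measurable_fun U (dens f).
Proof.
move=> mf; rewrite (funext (densE f)); apply/measurable_EFinP.
apply: measurable_funM.
  apply: measurable_funX.
  exact: measurableT_comp (@measurable_powR R _) (measurable_funTS measurable_fst).
apply: measurable_sum => j; have [f1 f2] := mf j.
by apply: measurable_funD; exact: measurable_funX.
Qed.

Lemma dens_scale (x : R[i]) f w :
  dens (fun w => x *: f w) w = ((cabs2 x)%:E * dens f w)%E.
Proof. by rewrite !densE vnorm2Z -EFinM mulrCA. Qed.

Lemma densD_le f g w e : 0 < e -> (dens (fun w => (f w + g w)%R) w <=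
  (1 + e)%:E * dens f w + (1 + e^-1)%:E * dens g w)%E.
Proof.
move=> e0; rewrite /dens -!EFinM -EFinD lee_fin.
by rewrite /kappa scalerDr; exact: vnorm2D_le.
Qed.

Local Open Scope ereal_scope.

Lemma wmeanD_le f g z e : L0 f -> L0 g -> U z -> (0 < e)%R ->
  wmean (dens (fun w => f w + g w)%R) z <=
  (1 + e)%:E * wmean (dens f) z + (1 + e^-1)%:E * wmean (dens g) z.
Proof.
move=> mf mg Uz e0.
have d1 : (0 <= 1 + e)%R by rewrite addr_ge0// ltW.
have d2 : (0 <= 1 + e^-1)%R by rewrite addr_ge0// invr_ge0 ltW.
rewrite /wmean muleCA [X in _ <= _ + X]muleCA -ge0_muleDr; last 2 first.
- by rewrite mule_ge0 ?wint_ge0// => w _; exact: dens_ge0.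
- by rewrite mule_ge0 ?wint_ge0// => w _; exact: dens_ge0.
apply: lee_wpmul2l; first exact/ltW/whitney_volume_inv_gt0.
have sub h : L0 h -> measurable_fun (Om z) (dens h).
  by move=> mh; exact: measurable_funS (Om_U Uz) (measurable_dens mh).
have dd h w : 0 <= dens h w := dens_ge0 h w.
rewrite /wint -ge0_integralZl_EFin//; last exact: sub.
rewrite -ge0_integralZl_EFin//; last exact: sub.
rewrite -ge0_integralD//; last 4 first.
- by move=> w _; rewrite mule_ge0.
- by apply: measurable_funeM; exact: sub.
- by move=> w _; rewrite mule_ge0.
- by apply: measurable_funeM; exact: sub.
apply: ge0_le_integral => //.
- by apply: sub; exact: L0_add.
- by apply: emeasurable_funD; apply: measurable_funeM; exact: sub.
- by move=> w _; exact: densD_le.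
Qed.

Lemma ZintD_le (p : R) f g : (0 < p <= 1)%R -> L0 f -> L0 g ->
  Zint (p / 2) (dens (fun w => f w + g w)%R) <=
  Zint (p / 2) (dens f) + Zint (p / 2) (dens g).
Proof.
move=> p01 mf mg; have /andP[p0 _] := p01.
have dd h w : U w -> 0 <= dens h w by move=> _; exact: dens_ge0.
have md h : L0 h ->
    measurable_fun U (fun z => wmean (dens h) z `^ (p / 2) * (z.1^-1)%:E).
  by move=> mh; exact: (measurable_Zint_fun _ (measurable_dens mh) (dd h)).
rewrite /Zint -ge0_integralD//; last 4 first.
- by move=> z; exact: Zint_fun_ge0.
- exact: md.
- by move=> z; exact: Zint_fun_ge0.
- exact: md.
apply: ge0_le_integral => //.
- by move=> z; exact: Zint_fun_ge0.
- exact: (md _ (L0_add mf mg)).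
- by apply: emeasurable_funD; exact: md.
move=> z Uz; have i0 : 0 <= (z.1^-1)%:E :> \bar R by rewrite lee_fin invr_ge0 ltW.
rewrite -ge0_muleDl ?poweR_ge0//; apply: lee_wpmul2r => //.
(* The exponent [p / 2] is taken in two stages: the square root gives the triangle inequality for
   quadratic means, and the power [p <= 1] is subadditive. *)
rewrite [(p / 2)%R]mulrC !poweRrM.
apply: le_trans (poweR_subadditive _ _ p01); rewrite ?poweR_ge0//.
apply: lee_poweR; rewrite ?poweR_ge0 ?(ltW p0)//.
apply: poweR_half_le_weighted; try by apply: wmean_ge0 => //; exact: dd.
by move=> e e0; exact: wmeanD_le.
Qed.

End density.

(** * Norm bound for a sum of atoms *)

Section atomic_upper_bound.
Context {R : realType}.
Variables (n N : nat) (s : R).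
Local Notation T := (R * n.-tuple R)%type.
Local Notation U := (@halfspace R n).
Local Notation mu := (@lebT R n).
Local Open Scope ereal_scope.
Implicit Types (z w : T) (f g : vfun R n N).

Lemma Znorm_Zint (p : R) f : Znorm p s f = Zint (p / 2) (dens s f) `^ p^-1.
Proof.
rewrite /Znorm /Zint; congr (_ `^ _); apply: eq_integral => z _.
by rewrite /whitney_avg -poweRrM mulrC.
Qed.

Lemma poweRVK (x : \bar R) (p : R) : (0 < p)%R -> 0 <= x -> (x `^ p^-1) `^ p = x.
Proof. by move=> p0 x0; rewrite -poweRrM mulVf ?gt_eqF// poweRe1. Qed.

Lemma Znorm_pow (p : R) f : (0 < p)%R ->
  Znorm p s f `^ p = Zint (p / 2) (dens s f).
Proof. by move=> p0; rewrite Znorm_Zint poweRVK// Zint_ge0. Qed.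

Lemma cabs_pow (x : R[i]) (p : R) : (cabs x `^ p = cabs2 x `^ (p / 2))%R.
Proof. by rewrite /cabs -powR12_sqrt ?cabs2_ge0// -powRrM mulrC. Qed.

Lemma dens0 w (f : vfun R n N) : f w = 0%R -> dens s f w = 0.
Proof. by move=> fw; rewrite densE fw vnorm2_0 mulr0. Qed.

(** The factor of exponent [n * (1 - p / 2)] in [Zint_atom] is cancelled exactly by the power [p] of
    the atom's size bound, whose exponent is [n * (1 / 2 - 1 / p)]; hence one constant for all
    atoms. *)
Lemma Zint_scaled_atom (c : R * R) (p : R) : whitney_param c -> (0 < p)%R ->
  exists2 C : R, (0 < C)%R & forall z (a : vfun R n N) (x : R[i]),
    Zatom p s c z a ->
    Zint (p / 2) (dens s (fun w => x *: a w)) <= (C * cabs x `^ p)%:E.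
Proof.
move=> cW p0; have p20 : (0 < p / 2)%R by rewrite divr_gt0.
have [C C0 atomC] := Zint_atom n cW p20; exists C => //.
move=> z a x [z0 [ma [neg nrm]]]; set D := fun w => x *: a w.
have mD : L0 D := L0_scale x ma.
apply: (le_trans (atomC z (dens s D) z0 (measurable_dens s mD) _ _)).
- by move=> w _; exact: dens_ge0.
- apply: negligibleS neg => w [Uw cw Dw]; rewrite /= mem_set//; split => //.
  split; first by apply/negP => /set_mem.
  apply: contra Dw => /eqP aw; apply/eqP/dens0.
  by rewrite /D aw scaler0.
set A := \int[mu]_(w in _) ((vnorm2 (kappa s a w))%:E * (w.1^-1)%:E) in nrm.
have mc : measurable (whitney_region n c z) by exact: measurable_whitney_region.
have c20 : (0 < c.2)%R by case: cW => _; apply: lt_trans; rewrite divr_gt0.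
have cU : whitney_region n c z `<=` U by apply: whitney_sub_halfspace.
have AE : \int[mu]_(w in whitney_region n c z) (dens s D w * (w.1^-1)%:E) =
    (cabs2 x)%:E * A.
  rewrite -ge0_integralZl_EFin ?cabs2_ge0//.
  - by apply: eq_integral => w _; rewrite dens_scale muleA.
  - by move=> w /cU w0; rewrite mule_ge0// lee_fin ?vnorm2_ge0// invr_ge0 ltW.
  - apply: (@measurable_funS _ _ _ _ U) cU _; first exact: measurable_halfspace.
    apply: emeasurable_funM; first exact: measurable_dens.
    by apply/measurable_EFinP; exact: measurable_invfst.
have A0 : 0 <= A.
  apply: integral_ge0 => w /cU w0.
  by rewrite mule_ge0// lee_fin ?vnorm2_ge0// invr_ge0 ltW.
rewrite AE poweRM// ?lee_fin ?cabs2_ge0// poweR_EFin -cabs_pow.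
rewrite EFinM -muleA [(cabs x `^ p)%:E * _]muleC !muleA EFinM.
apply: lee_wpmul2r; first by rewrite lee_fin powR_ge0.
rewrite -[leRHS]mule1 -muleA; apply: lee_wpmul2l; first by rewrite lee_fin ltW.
have -> : A `^ (p / 2) = (A `^ 2^-1) `^ p by rewrite -poweRrM mulrC.
apply: (@le_trans _ _ ((z.1 `^ (n%:R * (1 - p / 2)))%:E *
    (z.1 `^ (n%:R * (2^-1 - p^-1)))%:E `^ p)).
  apply: lee_wpmul2l; first by rewrite lee_fin powR_ge0.
  by apply: lee_poweR; [exact: ltW|exact: poweR_ge0|exact: nrm].
rewrite poweR_EFin -EFinM -powRrM -powRD; last first.
  by apply/implyP => _; rewrite gt_eqF.
rewrite (_ : (_ + _)%R = 0%R) ?powRr0//.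
by field; rewrite gt_eqF.
Qed.

Lemma Zint_sum (p : R) (a : nat -> vfun R n N) (lam : nat -> R[i]) m :
  (0 < p <= 1)%R -> (forall k, L0 (a k)) ->
  Zint (p / 2) (dens s (fun w => \sum_(k < m) lam k *: a k w)%R) <=
  \sum_(k < m) Zint (p / 2) (dens s (fun w => lam k *: a k w)).
Proof.
move=> p01 ma; elim: m => [|m ih].
  rewrite big_ord0 /Zint integral0_eq// => z Uz.
  rewrite /wmean /wint integral0_eq ?mule0 ?poweR0r ?mul0e//.
    by case/andP: p01 => p0 _; rewrite gt_eqF// divr_gt0.
  by move=> w _; apply: dens0; rewrite big_ord0.
rewrite big_ord_recr/= (_ : (fun w => _) =
    fun w => (\sum_(k < m) lam k *: a k w + lam m *: a m w)%R); last first.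
  by apply/funext => w; rewrite big_ord_recr.
apply: le_trans (ZintD_le s p01 _ _) _.
- exact: L0_sum.
- exact: L0_scale.
- exact: leeD2r.
Qed.

(** Split [f] into a remainder and a partial sum: the partial sums are bounded through the whole
    series uniformly in [m], and the remainder tends to zero in the quasinorm. *)
Lemma Zint_atomic_decomp (c : R * R) (p : R) :
  whitney_param c -> (0 < p <= 1)%R ->
  exists2 C : R, (0 < C)%R & forall f a lam, L0 f ->
    atomic_decomp p s c f a lam ->
  Zint (p / 2) (dens s f) <=
    C%:E * \sum_(0 <= k <oo) ((cabs (lam k)) `^ p)%:E.
Proof.
move=> cW p01; have /andP[p0 p1] := p01.
have [C C0 atomC] := Zint_scaled_atom cW p0; exists C => //.
move=> f a lam mf [atom [_ cv]].
have ma k : L0 (a k) by have [z [_ []]] := atom k.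
pose S m w : 'rV[R[i]]_N := (\sum_(k < m) lam k *: a k w)%R.
have step m : Zint (p / 2) (dens s f) <=
    Zint (p / 2) (dens s (fun w => f w - S m w)%R) +
    C%:E * \sum_(0 <= k <oo) ((cabs (lam k)) `^ p)%:E.
  have -> : dens s f = dens s (fun w => (f w - S m w) + S m w)%R.
    by apply/funext => w; rewrite /dens /kappa subrK.
  apply: le_trans (ZintD_le s p01 _ _) _.
  - exact: L0_sub_sum.
  - exact: L0_sum.
  apply: leeD2l; apply: le_trans (Zint_sum lam m p01 ma) _.
  apply: (@le_trans _ _ (\sum_(k < m) C%:E * ((cabs (lam k)) `^ p)%:E)).
    apply: lee_sum => k _; have [z az] := atom k.
    by rewrite -EFinM; exact: (atomC z).
  rewrite -ge0_sume_distrr; last by move=> k _; rewrite lee_fin powR_ge0.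
  apply: lee_wpmul2l; first by rewrite lee_fin ltW.
  rewrite -(big_mkord xpredT (fun k => ((cabs (lam k)) `^ p)%:E)).
  by apply: nneseries_lim_ge => k _ _; rewrite lee_fin powR_ge0.
apply/lee_addgt0Pr => e e0.
(* The convergence concerns [Znorm], whose power [p] is [Zint]; hence the threshold [e] to the power
   [1 / p]. *)
have ep0 : (0 < e `^ p^-1)%R by rewrite powR_gt0.
pose F m := Znorm p s (fun w => f w - S m w)%R.
have [m [Fm_fin Fm_lt]] : exists m, F m \is a fin_num /\ (fine (F m) < e `^ p^-1)%R.
  have /fine_cvgP[fin cvF] : F @ \oo --> 0%R%:E by exact: cv.
  have lt : \forall m \near \oo, (fine (F m) < e `^ p^-1)%R.
    exact: (cvgr_lt _ cvF _ ep0).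
  by have [m [h1 h2]] := filter_ex (filterI fin lt); exists m.
apply: le_trans (step m) _; rewrite addeC; apply: leeD2l.
rewrite -Znorm_pow//; apply: (@le_trans _ _ ((e `^ p^-1)%:E `^ p)).
  apply: lee_poweR; rewrite ?(ltW p0)//; first exact: poweR_ge0.
  by rewrite -/(F m) -(fineK Fm_fin) lee_fin ltW.
by rewrite poweR_EFin -powRrM mulVf ?gt_eqF// powRr1// ltW.
Qed.

End atomic_upper_bound.

(** * Cells and the atomic decomposition *)

Section whitney_grid.
Context {R : realType}.
Variables (n : nat) (c : R * R).
Hypothesis cW : whitney_param c.
Local Notation T := (R * n.-tuple R)%type.
Local Notation Om := (whitney_region n (1%R, 2%R)).
Local Notation U := (@halfspace R n).
Local Notation mu := (@lebT R n).
Implicit Types (z w : T) (i : (int * n.-tuple int)%type).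

(** [scale j] is the power [j] of [3 / 2]: layers of this ratio fit below the apertures
    [c.2 > 3 / 2] and 2. [eta] is the side of a cell relative to its height; the minimum keeps cells
    within both radii [c.1] and 1, and the divisor [n.+1] absorbs the factor [n] of [edist_le]. *)
Let eta : R := Num.min c.1 1 / n.+1%:R.
Let alpha : R := ln (3 / 2).
Let scale (j : int) : R := expR (alpha * j%:~R).

Let eta_gt0 : 0 < eta.
Proof. by case: cW => c0 _; rewrite divr_gt0// lt_min c0 ltr01. Qed.

Let alpha_gt0 : 0 < alpha.
Proof. by rewrite ln_gt0//; lra. Qed.

Let scale_gt0 j : 0 < scale j. Proof. exact: expR_gt0. Qed.

Let scaleS j : scale (j + 1) = 3 / 2 * scale j.
Proof.
rewrite /scale intrD mulrDr mulr1 expRD mulrC; congr (_ * _).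
by rewrite lnK// posrE.
Qed.

Definition corner i : T :=
  (scale i.1, [tuple (tnth i.2 l)%:~R * (eta * scale i.1) | l < n]).

Definition cell i : set T := cylinder (scale i.1) (3 / 2 * scale i.1)
  (eta * scale i.1) (corner i).2.

(** The layer is read off first, because the mesh of the spatial lattice depends on it. *)
Definition cell_index w : int * n.-tuple int :=
  let j := Num.floor (ln w.1 / alpha) in
  (j, [tuple Num.floor (tnth w.2 l / (eta * scale j)) | l < n]).

Let floorP (x : R) (m : int) : Num.floor x = m <-> m%:~R <= x < (m + 1)%:~R.
Proof. by split => [<-|]; [exact: floor_itv|exact: floor_def]. Qed.

Lemma cell_sub_halfspace i : cell i `<=` U.
Proof.
by move=> w [/= + _]; rewrite in_itv/= => /andP[+ _]; apply: lt_le_trans.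
Qed.

(** Seeing the cells as the fibres of a map on [U] gives disjointness and covering at once. *)
Lemma cell_indexP i w : cell i w <-> U w /\ cell_index w = i.
Proof.
have levP j : 0 < w.1 ->
    (Num.floor (ln w.1 / alpha) = j <-> scale j <= w.1 < 3 / 2 * scale j).
  move=> w0; rewrite floorP ler_pdivlMr// ltr_pdivrMr// -scaleS.
  have -> : (j%:~R * alpha <= ln w.1) = (scale j <= w.1).
    by rewrite -ler_expR lnK ?posrE// mulrC.
  have -> // : (ln w.1 < (j + 1)%:~R * alpha) = (w.1 < scale (j + 1)).
  by rewrite -ltr_expR lnK ?posrE// mulrC.
have boxP j (m : n.-tuple int) :
    box (eta * scale j) (corner (j, m)).2 w.2 <->
    [tuple Num.floor (tnth w.2 l / (eta * scale j)) | l < n] = m.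
  have e0 : 0 < eta * scale j by rewrite mulr_gt0.
  have coordP l : Num.floor (tnth w.2 l / (eta * scale j)) = tnth m l <->
      tnth (corner (j, m)).2 l <= tnth w.2 l <
      tnth (corner (j, m)).2 l + eta * scale j.
    rewrite floorP ler_pdivlMr// ltr_pdivrMr// tnth_mktuple/=.
    by rewrite intrD mulrDl mul1r.
  split => [h|mE l].
    by apply: eq_from_tnth => l; rewrite tnth_mktuple; exact/coordP.
  by apply/coordP; rewrite -mE tnth_mktuple.
split => [cw|[Uw <-]].
  have Uw := cell_sub_halfspace cw; split => //; case: cw => /=.
  rewrite in_itv/= => /levP wi wb; case: i wi wb => j m /= wi wb.
  by rewrite /cell_index wi//; congr pair; exact/boxP.
by split => /=; [rewrite in_itv/=; exact/levP|exact/boxP].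
Qed.

Lemma edist_cell i (x y : n.-tuple R) :
  (forall l, `|tnth x l - tnth y l| <= eta * scale i.1) ->
  Defs.edist x y < Num.min c.1 1 * scale i.1.
Proof.
move=> xy; apply: (@le_lt_trans _ _ (n%:R * (eta * scale i.1))).
  by apply: edist_le => //; rewrite mulr_ge0// ltW.
rewrite mulrA ltr_pM2r// /eta mulrCA -[ltRHS]mulr1 ltr_pM2l; last first.
  by case: cW => c0 _; rewrite lt_min c0 ltr01.
by rewrite ltr_pdivrMr// mul1r ltr_nat.
Qed.

Lemma cell_whitney i : cell i `<=` whitney_region n c (corner i).
Proof.
have [c0 c2] := cW; have c20 : 0 < c.2 by lra.
move=> w [/=]; rewrite in_itv/= => /andP[w1 w2] wb.
apply/whitney_regionP => /=; split.
- apply: lt_le_trans w1; rewrite ltr_pdivrMl// ltr_pMl//; lra.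
- by apply: lt_trans w2 _; rewrite ltr_pM2r.
- apply: (@lt_le_trans _ _ (Num.min c.1 1 * scale i.1)).
    apply: edist_cell => l; have /andP[h1 h2] := wb l.
    by rewrite ler_norml; apply/andP; split; lra.
  by rewrite ler_pM2r// ge_min lexx.
Qed.

Lemma cell_Om i z : cell i z -> cell i `<=` Om z.
Proof.
move=> [/=]; rewrite in_itv/= => /andP[z1 z2] zb.
move=> w [/=]; rewrite in_itv/= => /andP[w1 w2] wb.
have s0 := scale_gt0 i.1.
apply/whitney_regionP => /=; split; [lra|lra|].
apply: (@lt_le_trans _ _ (Num.min c.1 1 * scale i.1)).
  apply: edist_cell => l; have /andP[h1 h2] := wb l.
  have /andP[h3 h4] := zb l.
  by rewrite ler_norml; apply/andP; split; lra.
rewrite mul1r; apply: le_trans z1; apply: ler_piMl; first exact: ltW.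
by rewrite ge_min lexx orbT.
Qed.

(** The cells are numbered by [pickle], and a natural number need not code an index: hence the
    alternative of an empty [Q k]. *)
Lemma whitney_grid : exists (Q : nat -> set T) (zc : nat -> T) (r : R),
  [/\ 0 < r, trivIset setT Q, \bigcup_k Q k = U &
    forall k, measurable (Q k) /\
    [/\ 0 < (zc k).1, Q k `<=` whitney_region n c (zc k),
        forall w, Q k w -> (zc k).1 <= w.1 <= 3 / 2 * (zc k).1,
        forall z, Q k z -> Q k `<=` Om z &
        Q k = set0 \/ ((r * (zc k).1 ^+ n.+1)%:E <= mu (Q k))%E]].
Proof.
pose Q k := [set w | U w /\ pickle (cell_index w) = k].
pose ix k : int * n.-tuple int := odflt (0, [tuple 0 | _ < n]) (unpickle k).
have QE k w : Q k w -> Q k = cell (ix k).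
  move=> [_ wk]; apply/seteqP; split => v.
    by move=> [Uv <-]; apply/cell_indexP; rewrite /ix pickleK.
  move=> /cell_indexP[Uv vk]; split => //.
  by rewrite vk /ix -wk pickleK.
have Q0 k : Q k = set0 \/ Q k = cell (ix k).
  have [->|/set0P[w /QE]] := eqVneq (Q k) set0; [by left|by right].
have s0 k : 0 < scale (ix k).1 by exact: scale_gt0.
(* A cell has half its scale as height, and a base of side [eta] times its scale. *)
exists Q, (fun k => corner (ix k)), (eta ^+ n / 2); split.
- by rewrite divr_gt0// exprn_gt0.
- apply/trivIsetP => k l _ _ /eqP kl; apply/eqP/negPn/negP => /set0P.
  by move=> [w [[_ wk] [_ wl]]]; apply: kl; rewrite -wk.
- apply/seteqP; split => [w [k _ []]//|w Uw].
  by exists (pickle (cell_index w)).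
move=> k; split.
  by case: (Q0 k) => ->//; exact: measurable_cylinder.
split.
- exact: s0.
- by case: (Q0 k) => ->//; exact: cell_whitney.
- case: (Q0 k) => -> // w [/=]; rewrite in_itv/= => /andP[-> w2] _ /=.
  exact: ltW.
- by case: (Q0 k) => -> // z; exact: cell_Om.
- case: (Q0 k) => [->|->]; [by left|right].
  rewrite lebT_cylinder; last 2 first.
  + by have := s0 k; lra.
  + by rewrite mulr_ge0// ltW.
  rewrite lee_fin le_eqVlt; apply/orP; left; apply/eqP.
  rewrite (_ : (corner (ix k)).1 = scale (ix k).1)// exprS.
  by rewrite [X in _ = _ * X]exprMn; field.
Qed.

End whitney_grid.

Lemma ge0_cvge0P {R : realType} (u : nat -> \bar R) : (forall m, (0 <= u m)%E) ->
  u @ \oo --> 0%E <->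
  forall e : R, 0 < e -> \forall m \near \oo, (u m <= e%:E)%E.
Proof.
move=> u0; split => [/fine_cvgP[fin cvu] e e0|h].
  have lt : \forall m \near \oo, fine (u m) < e by exact: (cvgr_lt _ cvu _ e0).
  by apply: filterS2 fin lt => m fm um; rewrite -(fineK fm) lee_fin ltW.
have fin (e : R) : 0 < e -> \forall m \near \oo, u m \is a fin_num.
  move=> /h; apply: filterS => m um.
  by rewrite ge0_fin_numE// (le_lt_trans um)// ltry.
apply/fine_cvgP; split; first exact: (fin _ ltr01).
apply/cvgr0Pnorm_le => e e0.
apply: filterS2 (fin _ e0) (h _ e0) => m fm um /=.
by rewrite ger0_norm ?fine_ge0// -lee_fin fineK.
Qed.

(** * Construction of atoms from the cells *)

Section atomic_decomposition.
Context {R : realType}.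
Variables (n N : nat) (s : R) (c : R * R) (p : R).
Hypotheses (cW : whitney_param c) (p01 : 0 < p <= 1).
Local Notation T := (R * n.-tuple R)%type.
Local Notation Om := (whitney_region n (1%R, 2%R)).
Local Notation U := (@halfspace R n).
Local Notation mu := (@lebT R n).
Local Open Scope ereal_scope.
Implicit Types (z w : T) (f g : vfun R n N).

Let p0 : (0 < p)%R. Proof. by case/andP: p01. Qed.
Let q0 : (0 < p / 2)%R. Proof. by rewrite divr_gt0. Qed.
Let q01 : (0 < p / 2 <= 1)%R.
Proof. by rewrite q0/= ler_pdivrMr// mul1r; case/andP: p01 => _; lra. Qed.

Let mU : measurable U. Proof. exact: measurable_halfspace. Qed.

Lemma measurable_dens_restrict f (Q : set T) : L0 f -> measurable Q ->
  measurable_fun U (dens s f \_ Q).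
Proof.
move=> mf mQ; apply/measurable_restrict => //.
by apply: measurable_funS (measurable_dens s mf) => //; exact: subIsetl.
Qed.

Lemma dens_restrict_ge0 f (Q : set T) w : 0 <= (dens s f \_ Q) w.
Proof. by apply: erestrict_ge0 => v _; exact: dens_ge0. Qed.

Lemma int_restrict (Q W : set T) (f : vfun R n N) : Q `<=` W ->
  \int[mu]_(w in W) ((dens s f \_ Q) w * (w.1^-1)%:E) =
  \int[mu]_(w in Q) (dens s f w * (w.1^-1)%:E).
Proof.
move=> QW; rewrite -[in RHS](setIidr QW) integral_mkcondr.
by apply: eq_integral => w _; rewrite !patchE; case: ifPn => //; rewrite mul0e.
Qed.

Section cells.
Variables (Q : nat -> set T) (zc : nat -> T).
Hypotheses (tQ : trivIset setT Q) (UQ : \bigcup_k Q k = U).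
Hypothesis mQ : forall k, measurable (Q k).
Hypothesis zc_gt0 : forall k, (0 < (zc k).1)%R.
Hypothesis Qc : forall k, Q k `<=` whitney_region n c (zc k).
Variable f : vfun R n N.
Hypothesis mf : L0 f.

Let A k := \int[mu]_(w in Q k) (dens s f w * (w.1^-1)%:E).
(** This will be the power [p] of the coefficient of index [k], as [cabs_lam_pow] checks. *)
Let L k := ((zc k).1 `^ (n%:R * (1 - p / 2)))%:E * A k `^ (p / 2).

Hypothesis sumL : \sum_(0 <= k <oo) L k < +oo.

Let QU k : Q k `<=` U. Proof. by rewrite -UQ; exact: bigcup_sup. Qed.

Let A_ge0 k : 0 <= A k.
Proof.
apply: integral_ge0 => w /QU w0.
by rewrite mule_ge0 ?dens_ge0// lee_fin invr_ge0 ltW.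
Qed.

Let L_ge0 k : 0 <= L k.
Proof. by rewrite mule_ge0 ?poweR_ge0// lee_fin powR_ge0. Qed.

(** An infinite [A k] would make [L k] infinite, against [sumL]. *)
Let A_fin k : A k \is a fin_num.
Proof.
rewrite ge0_fin_numE//; apply: (@lty_poweRy _ _ (p / 2)); first exact: lt0r_neq0.
have : L k < +oo.
  apply: le_lt_trans sumL; apply: (@le_trans _ _ (\sum_(0 <= i < k.+1) L i)).
    by rewrite big_nat_recr//= leeDr// sume_ge0.
  by apply: nneseries_lim_ge => i _ _; exact: L_ge0.
apply: contraTT; rewrite -!leNgt !leye_eq => /eqP Ay.
by rewrite /L Ay gt0_muley// lte_fin powR_gt0.
Qed.

(** Chosen so that the part of [f] on [Q k], divided by it, has exactly the size allowed to an atom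
    at [zc k], if [A k] is not zero. *)
Let lamr k := ((zc k).1 `^ (n%:R * (p^-1 - 2^-1)) * fine (A k) `^ 2^-1)%R.

Let lam k : R[i] := ((lamr k)%:C)%C.

(** If [lamr k = 0], its inverse is 0 and [a k] is the zero function, still an atom. *)
Let a k : vfun R n N :=
  fun w => if w \in Q k then (((lamr k)^-1)%:C)%C *: f w else 0%R.

Let lamr_ge0 k : (0 <= lamr k)%R.
Proof. by rewrite mulr_ge0// powR_ge0. Qed.

Let cabs_lam k : cabs (lam k) = lamr k.
Proof. by rewrite /cabs cabs2_real sqrtr_sqr ger0_norm. Qed.

Let cabs_lam_pow k : (cabs (lam k) `^ p)%:E = L k.
Proof.
rewrite cabs_lam /lamr powRM ?powR_ge0// -!powRrM EFinM [(2^-1 * p)%R]mulrC.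
rewrite /L -[in RHS](fineK (A_fin k)) poweR_EFin; congr (_%:E * _).
by congr (_ `^ _)%R; field; rewrite gt_eqF.
Qed.

Let dens_a k w : dens s (a k) w =
  (((lamr k)^-1 ^+ 2)%:E * (dens s f \_ (Q k)) w).
Proof.
rewrite patchE /a densE; case: ifPn => _; last by rewrite vnorm2_0 mulr0 mule0.
by rewrite vnorm2Z cabs2_real densE -EFinM mulrCA.
Qed.

Let L0_a k : L0 (a k).
Proof. exact: (L0_restrict (mQ k) (L0_scale _ mf)). Qed.

Let mfi (W : set T) k : measurable W -> W `<=` U ->
  measurable_fun W (fun w => (dens s f \_ (Q k)) w * (w.1^-1)%:E).
Proof.
move=> mW WU; apply: (@measurable_funS _ _ _ _ U) => //.
apply: emeasurable_funM; first exact: measurable_dens_restrict.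
by apply/measurable_EFinP; exact: measurable_invfst.
Qed.

Let cU k : whitney_region n c (zc k) `<=` U.
Proof.
apply: whitney_sub_halfspace => //.
by case: cW => _; apply: lt_trans; rewrite divr_gt0.
Qed.

Let atom_a k : Zatom p s c (zc k) (a k).
Proof.
split=> //; split; first exact: L0_a.
split.
  rewrite (_ : [set _ | _] = set0); first exact: negligible_set0.
  apply/seteqP; split => // w [_ [wc]]; rewrite /a; case: ifPn => [/set_mem wQ|].
    by move/negP: wc; case; apply/mem_set/Qc.
  by rewrite eqxx.
have -> : \int[mu]_(w in whitney_region n c (zc k))
    ((vnorm2 (kappa s (a k) w))%:E * (w.1^-1)%:E) = ((lamr k)^-1 ^+ 2)%:E * A k.
  rewrite /A -(int_restrict _ (@Qc k)) -ge0_integralZl_EFin ?sqr_ge0//.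
  - by apply: eq_integral => w _; rewrite muleA -dens_a.
  - exact: measurable_whitney_region.
  - move=> w /cU w0; rewrite mule_ge0 ?dens_restrict_ge0//.
    by rewrite lee_fin invr_ge0 ltW.
  - by apply: mfi; [exact: measurable_whitney_region|exact: cU].
rewrite -(fineK (A_fin k)) -EFinM poweR_EFin lee_fin.
rewrite powRM ?sqr_ge0 ?fine_ge0// powR12_sqrt ?sqr_ge0// sqrtr_sqr.
rewrite ger0_norm ?invr_ge0//.
have tE : ((zc k).1 `^ (n%:R * (2^-1 - p^-1)) =
    ((zc k).1 `^ (n%:R * (p^-1 - 2^-1)))^-1)%R.
  by rewrite -powRN; congr (_ `^ _)%R; ring.
rewrite tE /lamr.
have t0 : (0 < (zc k).1 `^ (n%:R * (p^-1 - 2^-1)))%R by rewrite powR_gt0.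
have [->|a0] := eqVneq (fine (A k) `^ 2^-1)%R 0%R.
  by rewrite mulr0 invr_ge0 ltW.
by rewrite invfM -mulrA mulVf// mulr1.
Qed.

Lemma cell_decomposition :
  exists (a : nat -> vfun R n N) (lam : nat -> R[i]),
    atomic_decomp p s c f a lam /\
    \sum_(0 <= k <oo) (cabs (lam k) `^ p)%:E = \sum_(0 <= k <oo) L k.
Proof.
have [C C0 atomC] := Zint_atom n cW q0.
have sumE : \sum_(0 <= k <oo) (cabs (lam k) `^ p)%:E = \sum_(0 <= k <oo) L k.
  by apply: eq_eseriesr => k _; exact: cabs_lam_pow.
exists a, lam; split=> //; split; first by move=> k; exists (zc k).
split; first by rewrite /lpnorm sumE poweR_lty.
(* What the partial sum of length [m] leaves of the density on [Q k]. Cells with [lamr k = 0] are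
   always kept: there [f] vanishes only almost everywhere, so subtracting a zero term need not
   cancel it pointwise. *)
pose H m k : T -> \bar R :=
  if ((m <= k)%N || (lamr k == 0%R)) then dens s f \_ (Q k) else cst 0.
have mH m k : measurable_fun U (H m k).
  by rewrite /H; case: ifP => _ //; exact: measurable_dens_restrict.
have H0 m k w : U w -> 0 <= H m k w.
  by rewrite /H; case: ifP => _ // _; exact: dens_restrict_ge0.
have ZH m k : Zint (p / 2) (H m k) <= if (m <= k)%N then C%:E * L k else 0.
  have Zk : Zint (p / 2) (dens s f \_ (Q k)) <= C%:E * L k.
    apply: le_trans (atomC (zc k) _ (zc_gt0 k) _ _ _) _.
    - exact: measurable_dens_restrict.
    - by move=> w _; exact: dens_restrict_ge0.
    - rewrite (_ : [set _ | _] = set0); first exact: negligible_set0.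
      apply/seteqP; split => // w [_ wc]; rewrite patchE.
      case: ifPn => [/set_mem wQ|].
        by move: wc; case; exact: Qc.
      by rewrite eqxx.
    by rewrite (int_restrict _ (@Qc k)) /L -/(A k) EFinM muleA.
  have Z0 : Zint (p / 2) (cst 0 : T -> \bar R) = 0.
    rewrite /Zint integral0_eq// => z Uz.
    by rewrite /wmean /wint integral0 mule0 poweR0r ?mul0e// gt_eqF.
  rewrite /H; have [mk//|mk] := leqP m k.
  (* A cell kept only because its coefficient vanishes costs nothing, since [L k = 0] there. *)
  have [lk0|lk0] := eqVneq (lamr k) 0%R; rewrite /= ?Z0//.
  apply: le_trans Zk _; rewrite -cabs_lam_pow cabs_lam lk0 powR0 ?gt_eqF//.
  by rewrite mule0.
pose S m w : 'rV[R[i]]_N := (\sum_(k < m) lam k *: a k w)%R.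
(* By disjointness only the atom of index [k] can be non-zero on [Q k]. *)
have SE m k w : Q k w -> S m w = if (k < m)%N then lam k *: a k w else 0%R.
  move=> Qw; have out i : i != k -> a i w = 0%R.
    move=> ik; rewrite /a; case: ifPn => // /set_mem Qi.
    by have := tQ I I (ex_intro _ w (conj Qi Qw)) => /eqP; rewrite (negbTE ik).
  rewrite /S; case: ltnP => km.
    rewrite (bigD1 (Ordinal km))//= big1 ?addr0// => i /eqP ik.
    by rewrite out ?scaler0//; apply/eqP => ik'; apply: ik; exact/val_inj.
  rewrite big1// => i _; rewrite out ?scaler0//; apply/eqP => ik.
  by have := ltn_ord i; rewrite ik ltnNge km.
have densS m w : U w ->
    dens s (fun w => f w - S m w)%R w <= \sum_(0 <= k <oo) H m k w.
  move=> Uw; have [k _ Qw] : (\bigcup_k Q k) w by rewrite UQ.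
  apply: (@le_trans _ _ (H m k w)); last first.
    apply: (@le_trans _ _ (\sum_(0 <= i < k.+1) H m i w)).
      by rewrite big_nat_recr//= leeDr// sume_ge0// => i _; exact: H0.
    by apply: nneseries_lim_ge => i _ _; exact: H0.
  rewrite densE (SE _ _ _ Qw) /H.
  have fE : (dens s f \_ (Q k)) w = dens s f w by rewrite patchE mem_set.
  case: ltnP => /= mk; last by rewrite subr0 -densE fE.
  rewrite /a mem_set// /lam scalerA -rmorphM/=.
  have [->|lk0] := eqVneq (lamr k) 0%R.
    by rewrite mul0r scale0r subr0 -densE fE.
  by rewrite mulfV// scale1r subrr vnorm2_0 mulr0.
(* The remainder is dominated by the sum of the pieces [H m k], to which countable subadditivity and
   the bound for a single cell apply. *)
have tail m : Zint (p / 2) (dens s (fun w => f w - S m w)%R) <=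
    C%:E * \sum_(m <= k <oo) L k.
  apply: (@le_trans _ _ (Zint (p / 2) (fun w => \sum_(0 <= k <oo) H m k w))).
    apply: le_Zint; [exact: ltW| | | |].
    - by apply: measurable_dens; exact: L0_sub_sum.
    - by apply: ge0_emeasurable_sum => [k w Uw _|k _]; [exact: H0|exact: mH].
    - by move=> w _; exact: dens_ge0.
    - exact: densS.
  apply: le_trans (Zint_nneseries q01 (mH m) (H0 m)) _.
  apply: (@le_trans _ _ (\sum_(0 <= k <oo) if (m <= k)%N then C%:E * L k else 0)).
    by apply: lee_nneseries => [k _ _|k _]; [exact: Zint_ge0|exact: ZH].
  rewrite -eseries_mkcond -nneseriesZl; last by move=> k _; exact: L_ge0.
  by rewrite [leRHS]eseries_cond.
have Zcv : (fun m => \sum_(m <= k <oo) L k) @ \oo --> 0.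
  exact: nneseries_tail_cvg.
have S0 m : 0 <= \sum_(m <= k <oo) L k.
  by apply: nneseries_ge0 => k _ _; exact: L_ge0.
apply/ge0_cvge0P => [m|e e0]; first exact: poweR_ge0.
have /(ge0_cvge0P S0) := Zcv.
(* Chosen so that [C] times the tail is at most the power [p] of [e]. *)
have d0 : (0 < e `^ p / C)%R by rewrite divr_gt0// powR_gt0.
move=> /(_ _ d0); apply: filterS => m tm; rewrite Znorm_Zint.
apply: (@le_trans _ _ ((e `^ p)%:E `^ p^-1)).
  apply: lee_poweR; [by rewrite invr_ge0 ltW|exact: Zint_ge0|].
  apply: le_trans (tail m) _.
  apply: (@le_trans _ _ (C%:E * (e `^ p / C)%:E)).
    by apply: lee_wpmul2l => //; rewrite lee_fin ltW.
  by rewrite -EFinM mulrCA mulfV ?gt_eqF// mulr1.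
by rewrite poweR_EFin -powRrM mulfV ?gt_eqF// powRr1// ltW.
Qed.

End cells.
End atomic_decomposition.

(** The cells are disjoint with union [U], so the right-hand sides of [Zint_cell] add up to a
    multiple of [Zint]. This also provides the summability that [cell_decomposition] asks for. *)
Lemma exists_atomic_decomp {R : realType} (n N : nat) (s : R) (c : R * R)
    (p : R) : whitney_param c -> 0 < p <= 1 ->
  exists2 C : R, 0 < C & forall f : vfun R n N, L0 f ->
    (Zint (p / 2) (dens s f) < +oo)%E ->
    exists (a : nat -> vfun R n N) (lam : nat -> R[i]),
      atomic_decomp p s c f a lam /\
      (\sum_(0 <= k <oo) (cabs (lam k) `^ p)%:E <=
       C%:E * Zint (p / 2) (dens s f))%E.
Proof.
move=> cW p01; have [Q [zc [r [r0 tQ UQ QP]]]] := whitney_grid n cW.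
have p0 : 0 < p by case/andP: p01.
have q0 : 0 < p / 2 by rewrite divr_gt0.
have [C C0 cellC] := Zint_cell n q0 r0; exists C => // f mf Zf.
have mQ k : measurable (Q k) by case: (QP k).
have zc0 k : 0 < (zc k).1 by case: (QP k) => _ [].
have Qc k : Q k `<=` whitney_region n c (zc k) by case: (QP k) => _ [].
have QU k : Q k `<=` halfspace n by rewrite -UQ; exact: bigcup_sup.
pose L k := (((zc k).1 `^ (n%:R * (1 - p / 2)))%:E *
  (\int[lebT n]_(w in Q k) (dens s f w * (w.1^-1)%:E)) `^ (p / 2))%E.
pose F z := (wmean (dens s f) z `^ (p / 2) * (z.1^-1)%:E)%E.
have F0 z : halfspace n z -> (0 <= F z)%E by exact: Zint_fun_ge0.
have mF : measurable_fun (halfspace n) F.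
  apply: measurable_Zint_fun; first exact: measurable_dens.
  by move=> w _; exact: dens_ge0.
have L_le k : (L k <= C%:E * \int[lebT n]_(z in Q k) F z)%E.
  have [_ [_ _ Qt QOm [Qk|muQ]]] := QP k.
    by rewrite /L Qk !integral_set0 poweR0r ?gt_eqF// !mule0.
  apply: cellC => //; first exact: measurable_dens.
  by move=> w _; exact: dens_ge0.
have sum_le : (\sum_(0 <= k <oo) L k <= C%:E * Zint (p / 2) (dens s f))%E.
  rewrite /Zint -/F -UQ ge0_integral_bigcup//; last 2 first.
  - by rewrite UQ.
  - by move=> z; rewrite UQ; exact: F0.
  rewrite -nneseriesZl; last first.
    by move=> k _; apply: integral_ge0 => z /QU; exact: F0.
  apply: lee_nneseries => [k _ _|k _]; last exact: L_le.
  by rewrite mule_ge0 ?poweR_ge0// lee_fin powR_ge0.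
have sum_fin : (\sum_(0 <= k <oo) L k < +oo)%E.
  by apply: le_lt_trans sum_le _; rewrite lte_mul_pinfty ?lee_fin// ltW.
have [a [lam [fal sumE]]] := cell_decomposition cW p01 tQ UQ mQ zc0 Qc mf sum_fin.
by exists a, lam; split => //; rewrite sumE.
Qed.

(** * Membership criterion and equivalence of the quasinorms *)

Unset Implicit Arguments.

Theorem theorem2p25 (R : realType) (n N : nat) (p s : R) (c : R * R) :
  (1 <= n)%N -> (1 <= N)%N ->
  0 < p -> p <= 1 -> whitney_param c ->
  (forall f : vfun R n N, L0 f ->
     (in_Z p s f <-> exists a lam, atomic_decomp p s c f a lam)) /\
  exists C : R, 0 < C /\
    forall f : vfun R n N, in_Z p s f ->
      ((C^-1)%:E * ereal_inf (decomp_norms p s c f) <= Znorm p s f)%E /\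
      (Znorm p s f <= C%:E * ereal_inf (decomp_norms p s c f))%E.
Proof.
move=> _ _ p0 p1 cW; have p01 : 0 < p <= 1 by rewrite p0.
have ip0 : 0 <= p^-1 by rewrite invr_ge0 ltW.
have [C1 C10 ub] := Zint_atomic_decomp n N s cW p01.
have [C2 C20 lb] := exists_atomic_decomp n N s cW p01.
have C1e : (0 <= C1%:E)%E by rewrite lee_fin ltW.
have C2e : (0 <= C2%:E)%E by rewrite lee_fin ltW.
have sum0 (lam : nat -> R[i]) :
    (0 <= \sum_(0 <= k <oo) (cabs (lam k) `^ p)%:E)%E.
  by apply: nneseries_ge0 => k _ _; rewrite lee_fin powR_ge0.
have Znorm_fin (f : vfun R n N) :
    (Znorm p s f < +oo -> Zint (p / 2) (dens s f) < +oo)%E.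
  by rewrite Znorm_Zint; apply: lty_poweRy; rewrite invr_neq0// gt_eqF.
have ub_norm (f : vfun R n N) (a : nat -> vfun R n N) lam :
    L0 f -> atomic_decomp p s c f a lam ->
    (Znorm p s f <= (C1 `^ p^-1)%:E * lpnorm p lam)%E.
  move=> mf fal; rewrite Znorm_Zint /lpnorm -poweR_EFin -poweRM ?sum0 ?C1e//.
  exact: (lee_poweR ip0 (Zint_ge0 _ _) (ub f a lam mf fal)).
split=> [f mf|].
  split=> [[_ Zf]|[a [lam fal]]].
    have [a [lam [fal _]]] := lb f mf (Znorm_fin _ Zf).
    by exists a, lam.
  split=> //; apply: le_lt_trans (ub_norm _ _ _ mf fal) _.
  by rewrite lte_mul_pinfty ?lee_fin ?powR_ge0//; case: fal => _ [].
(* The two estimates concern powers [p], hence the exponent [1 / p]; the maximum serves both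
   directions. *)
pose C := Num.max (C1 `^ p^-1) (C2 `^ p^-1).
have C0 : 0 < C by rewrite lt_max powR_gt0.
exists C; split=> // f [mf Zf]; split.
  (* The infimum is at most the norm of the one decomposition built from cells. *)
  have [a [lam [fal sumle]]] := lb f mf (Znorm_fin _ Zf).
  rewrite lee_pdivrMl//; apply: (@le_trans _ _ (lpnorm p lam)).
    by apply: ereal_inf_lbound; exists a, lam.
  apply: (@le_trans _ _ ((C2 `^ p^-1)%:E * Znorm p s f)%E).
    rewrite Znorm_Zint /lpnorm -poweR_EFin -poweRM ?Zint_ge0 ?C2e//.
    exact: (lee_poweR ip0 (sum0 lam) sumle).
  by apply: lee_wpmul2r; [exact: poweR_ge0|rewrite lee_fin le_max lexx orbT].
(* The upper bound holds for every decomposition of [f], hence for the infimum. *)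
rewrite -lee_pdivrMl//; apply: le_ereal_inf_tmp => _ [a [lam [fal ->]]].
rewrite lee_pdivrMl//; apply: le_trans (ub_norm _ _ _ mf fal) _.
by apply: lee_wpmul2r; [exact: poweR_ge0|rewrite lee_fin le_max lexx].
Qed.
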